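(* Determining if a given graph $G$ contains the house as an induced topological minor can be done in polynomial time (in the size of $G$).
   Context: Graphs are finite, simple and undirected. A graph $H$ is an induced topological minor of $G$ if some subdivision of $H$ (obtained by repeatedly, zero or more times, replacing an edge $uv$ by two edges $uw,wv$ with $w$ a new vertex) is isomorphic to an induced subgraph of $G$. The house is the graph with vertices $a,b,c,d,e$ and edges $ab,bc,cd,de,ae,ad$. *)

(* Defs.v *)
From HB Require Import structures.
From mathcomp Require Import all_boot.

Set Implicit Arguments.
Unset Strict Implicit.
Unset Printing Implicit Defensive.

(** * Finite simple graphs *)

Record sgraph := SGraph {
  vertex :> finType;
  adj : rel vertex;
  adj_sym : symmetric adj;
  adj_irrefl : irreflexive adj }.

Definition isomorphic (G H : sgraph) : Prop :=
  exists2 f : G -> H, bijective f & forall x y, adj (f x) (f y) = adj x y.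

Section InducedSubgraph.
Variables (G : sgraph) (S : {set G}).

Definition induced_adj : rel {x : G | x \in S} :=
  fun x y => adj (val x) (val y).

Lemma induced_adj_sym : symmetric induced_adj.
Proof. by move=> x y; apply: adj_sym. Qed.

Lemma induced_adj_irrefl : irreflexive induced_adj.
Proof. by move=> x; apply: adj_irrefl. Qed.

Definition induced : sgraph := SGraph induced_adj_sym induced_adj_irrefl.
End InducedSubgraph.

(** * Subdivisions *)

(* [subdivide_edge u v] is meant for an edge [uv]: the new vertex is [None],
   and the edge [uv] is replaced by the two edges [u None] and [None v]. *)
Section SubdivideEdge.
Variables (G : sgraph) (u v : G).

Definition subdivide_adj : rel (option G) := fun x y =>
  match x, y with
  | Some x, Some y =>
      [&& adj x y, (x, y) != (u, v) & (x, y) != (v, u)]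
  | Some x, None | None, Some x => (x == u) || (x == v)
  | None, None => false
  end.

Lemma subdivide_adj_sym : symmetric subdivide_adj.
Proof.
move=> [x|] [y|] //=; rewrite adj_sym !xpair_eqE; congr andb.
by rewrite andbC [(x == v) && _]andbC [(x == u) && _]andbC.
Qed.

Lemma subdivide_adj_irrefl : irreflexive subdivide_adj.
Proof. by move=> [x|] //=; rewrite adj_irrefl. Qed.

Definition subdivide_edge : sgraph :=
  SGraph subdivide_adj_sym subdivide_adj_irrefl.
End SubdivideEdge.

Inductive subdivision (H : sgraph) : sgraph -> Prop :=
| subdivision_refl : subdivision H H
| subdivision_step (K : sgraph) (u v : K) :
    subdivision H K -> adj u v -> subdivision H (subdivide_edge u v).

Definition induced_topological_minor (H G : sgraph) : Prop :=
  exists2 K : sgraph, subdivision H K &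
    exists S : {set G}, isomorphic K (induced S).

(** * The house *)

(* The vertices a, b, c, d, e are 0, 1, 2, 3, 4. *)
Definition house_edges : seq (nat * nat) :=
  [:: (0, 1); (1, 2); (2, 3); (3, 4); (0, 4); (0, 3)].

Definition house_adj : rel 'I_5 := fun x y =>
  ((val x, val y) \in house_edges) || ((val y, val x) \in house_edges).

Lemma house_adj_sym : symmetric house_adj.
Proof. by move=> x y; apply: orbC. Qed.

Lemma house_adj_irrefl : irreflexive house_adj.
Proof. by case=> [[|[|[|[|[|]]]]]]. Qed.

Definition house : sgraph := SGraph house_adj_sym house_adj_irrefl.

(** * Random access machines *)

(* Cook and Reckhow's random access machine, over the natural numbers and with
   an input array that is read by index.  The only arithmetic is addition and
   truncated subtraction, so register values have at most linearly many bits
   in the number of steps; hence polynomial time with one unit of time per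
   instruction is the same as polynomial time on Turing machines. *)
Inductive instr :=
| ISet of nat & nat         (* ISet i c    : X_i := c *)
| IAdd of nat & nat & nat   (* IAdd i j k  : X_i := X_j + X_k *)
| ISub of nat & nat & nat   (* ISub i j k  : X_i := X_j - X_k *)
| ILoad of nat & nat        (* ILoad i j   : X_i := X_(X_j) *)
| IStore of nat & nat       (* IStore i j  : X_(X_i) := X_j *)
| IRead of nat & nat        (* IRead i j   : X_i := input entry X_j *)
| IJump of nat & nat.       (* IJump j m   : goto m if X_j > 0 *)

Definition program := seq instr.

Record state := State { pc : nat; reg : nat -> nat }.

(* Input entries are numbered from 0; those past the end read as 0. *)
Definition exec (input : seq nat) (ins : instr) (s : state) : state :=
  let: State p X := s in
  match ins with
  | ISet i c => State p.+1 [eta X with i |-> c]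
  | IAdd i j k => State p.+1 [eta X with i |-> X j + X k]
  | ISub i j k => State p.+1 [eta X with i |-> X j - X k]
  | ILoad i j => State p.+1 [eta X with i |-> X (X j)]
  | IStore i j => State p.+1 [eta X with X i |-> X j]
  | IRead i j => State p.+1 [eta X with i |-> nth 0 input (X j)]
  | IJump j m => State (if 0 < X j then m else p.+1) X
  end.

(* The machine halts by leaving the program. *)
Definition halted (prog : program) (s : state) : bool := size prog <= pc s.

Definition step (prog : program) (input : seq nat) (s : state) : state :=
  if onth prog (pc s) is Some ins then exec input ins s else s.

Definition init_state : state := State 0 (fun=> 0).

Definition run (prog : program) (input : seq nat) (t : nat) : state :=
  iter t (step prog input) init_state.

Definition accepting (s : state) : bool := reg s 0 != 0.

(** * Graph problems decidable in polynomial time *)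

(* The number of vertices, followed by the adjacency matrix row by row. *)
Definition encode (G : sgraph) : seq nat :=
  #|G| :: [seq nat_of_bool (adj x y) | x <- enum G, y <- enum G].

(* The bound is in the number n of vertices; the number of edges is at most
   n ^ 2, so a bound polynomial in n plus the number of edges is the same. *)
Definition poly_time_decidable (P : sgraph -> Prop) : Prop :=
  exists (prog : program) (c k : nat), forall G : sgraph,
    exists2 t : nat, t <= c * #|G| ^ k + c &
      halted prog (run prog (encode G) t) /\
      (accepting (run prog (encode G) t) <-> P G).

(* Main.v *)
Require Import Defs.
From mathcomp Require Import all_boot.
From mathcomp Require Import zify.

(* A subdivision of the house consists of two vertices [a], [d] joined by three internally
   disjoint paths with p, q, r internal vertices, where at most one of p, q, r is 0 and at least
   one is 2 or more; call an induced subgraph of this kind a theta.  A theta can be found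
   by guessing six of its vertices and testing reachability.

   If one of the paths is the edge [ad] and another one has at most two internal vertices, the
   theta is found exactly: guess the short path and the ends of the third one, and connect these
   ends outside the closed neighbourhood of the short path.  Otherwise the theta contains an
   induced cycle C of length at least 5 through an end [a] and a path leaving C at [a].  Guess
   the four consecutive vertices [a1 a a2 w] of C around the edge [a a2] and the first vertex [s]
   of the path.  Every shortest way to close [a1 a a2 w] avoiding the neighbours of [a] and [a2]
   gives an induced cycle C', and every shortest way to go from [s] to C' while avoiding the
   neighbours of [a] meets C' in one, two adjacent, or two or more distant vertices; in each case
   a theta, not always the original one, appears.  So the guess need not know the cycle.

   Both tests are first-order formulas with a reachability operator.  Such formulas are compiled
   to the machine; reachability is computed by n rounds of relaxation on an array of marks. *)

Set Implicit Arguments.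
Unset Strict Implicit.
Unset Printing Implicit Defensive.

(** * Structured programs *)

(** Testing each arm of a theta for reachability separately does not keep the arms apart: already
    finding an induced cycle through two given vertices is NP-complete. The short test escapes
    because two of its three arms are guessed completely, so that a single reachability test
    remains. The long test makes two independent ones, whose paths may interfere, and its side
    conditions make every interference harmless. The vertex [s] must miss [a1] and [a2], because a
    vertex that sees exactly the consecutive vertices [a1], [a], [a2] of a hole yields no theta of
    the required sizes. The length 5 matters when the contacts produce three arms of one vertex
    each, which is too short for a subdivided house: the rest of the hole then has at least two
    vertices and supplies a longer arm. Distances are never measured; an induced path extracted from
    a walk replaces a shortest one. *)

Definition reloc (p : nat) (ins : instr) : instr :=
  if ins is IJump j m then IJump j (p + m) else ins.

Definition jump_free (ins : instr) : bool := if ins is IJump _ _ then false else true.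

Notation regs := (nat -> nat).

(* Register 0 holds results and registers 1 and 2 are scratch. *)
Notation rN := 3.
Notation rOne := 4.
Notation rZero := 5.
Notation rSp := 6.

Section Runs.
Variable input : seq nat.

Definition runs_from (c : program) (p : nat) (X : regs) (p' : nat) (X' : regs) (T : nat) :=
  exists2 t, t <= T & iter t (step c input) (State p X) = State p' X'.

(** The final position [size c] is both the halting position of [c] alone and the entry point of
    whatever code is placed after it. *)
Definition runs (c : program) (X X' : regs) (T : nat) := runs_from c 0 X (size c) X' T.

Lemma step_onth c p X ins :
  onth c p = Some ins -> step c input (State p X) = exec input ins (State p X).
Proof. by rewrite /step /= => ->. Qed.

Lemma runs_from_refl c p X : runs_from c p X p X 0.
Proof. by exists 0. Qed.

Lemma runs_from_trans c p1 X1 p2 X2 p3 X3 T1 T2 :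
  runs_from c p1 X1 p2 X2 T1 -> runs_from c p2 X2 p3 X3 T2 ->
  runs_from c p1 X1 p3 X3 (T1 + T2).
Proof.
move=> [t1 le1 e1] [t2 le2 e2]; exists (t2 + t1); first by rewrite addnC leq_add.
by rewrite iterD e1 e2.
Qed.

Lemma runs_from_le c p X p' X' T T' :
  T <= T' -> runs_from c p X p' X' T -> runs_from c p X p' X' T'.
Proof. by move=> le_T [t le_t e]; exists t => //; apply: leq_trans le_T. Qed.

Lemma runs_le c X X' T T' : T <= T' -> runs c X X' T -> runs c X X' T'.
Proof. exact: runs_from_le. Qed.

Lemma runs_from_step c p X ins p' X' :
  onth c p = Some ins -> exec input ins (State p X) = State p' X' ->
  runs_from c p X p' X' 1.
Proof. by move=> ins_p e; exists 1; rewrite //= /step /= ins_p. Qed.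

Lemma runs_from_embed pre c post X X' T :
  runs c X X' T ->
  runs_from (pre ++ map (reloc (size pre)) c ++ post) (size pre) X (size pre + size c) X' T.
Proof.
rewrite -[X in runs_from _ X _ _ _ _]addn0 /runs /runs_from; move: 0 => p [t le_t].
elim: t p X T le_t => [|t IH] p X T le_t; first by case=> -> ->; exists 0.
rewrite iterSr; case: (ltnP p (size c)) => [lt_p | ge_p]; last first.
  (* After [c] has halted its remaining steps are idle, whereas the host program would go on into
     [post]. These steps are dropped, which is why times are upper bounds and not exact. *)
  have stuck: step c input (State p X) = State p X.
    by rewrite /step /= onth_default.
  by rewrite stuck => e; apply: (IH _ _ _ _ e); apply: ltnW.
case: T le_t => // T le_t.
have [ins ins_p]: exists ins, onth c p = Some ins.
  by move: lt_p; rewrite -onthTE; case: onth => // ins _; exists ins.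
rewrite (step_onth _ ins_p).
have ins_q: onth (pre ++ map (reloc (size pre)) c ++ post) (size pre + p)
            = Some (reloc (size pre) ins).
  by rewrite !onth_cat ltnNge leq_addr addKn size_map lt_p onth_map ins_p.
case E: (exec input ins (State p X)) => [p1 X1] e0; have [t' le_t' e] := IH _ _ _ le_t e0.
exists t'.+1; rewrite // iterSr (step_onth _ ins_q) -e; congr iter.
clear - E; case: ins E => [i c|i j k|i j k|i j|i j|i j|i j] /= [<- <-]; rewrite ?addnS //.
by case: ifP; rewrite ?addnS.
Qed.

Definition seqc (c1 c2 : program) : program := c1 ++ map (reloc (size c1)) c2.

(** A jump on [rOne], which always holds 1, is unconditional. A positive [r] skips the jump to the
    end. *)
Definition ifc (r : nat) (c : program) : program :=
  [:: IJump r 2; IJump rOne (size c).+2] ++ map (reloc 2) c.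

(** The counter is decremented before the body, so that a loop started at the number of vertices
    presents the ranks from the last one down to 0. *)
Definition loop (v : nat) (c : program) : program :=
  [:: IJump v 2; IJump rOne (size c).+4; ISub v v rOne] ++ map (reloc 3) c ++ [:: IJump rOne 0].

Lemma runs_seq c1 c2 X X1 X2 T1 T2 :
  runs c1 X X1 T1 -> runs c2 X1 X2 T2 -> runs (seqc c1 c2) X X2 (T1 + T2).
Proof.
move=> /(runs_from_embed [::] (map (reloc (size c1)) c2)) /= r1.
move=> /(runs_from_embed c1 [::]); rewrite cats0 => r2.
have idc: map (reloc 0) c1 = c1 by rewrite -[RHS]map_id; apply: eq_map => -[].
rewrite idc add0n in r1.
rewrite /runs /seqc size_cat size_map; exact: runs_from_trans r1 r2.
Qed.

Lemma runs_if_true r c X X' T :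
  0 < X r -> runs c X X' T -> runs (ifc r c) X X' T.+1.
Proof.
move=> Xr /(runs_from_embed [:: IJump r 2; IJump rOne (size c).+2] [::]).
rewrite cats0 /runs /ifc size_cat size_map => r1.
by rewrite -[T.+1]add1n; apply: runs_from_trans r1; apply: runs_from_step; rewrite //= Xr.
Qed.

Lemma runs_if_false r c X :
  X r = 0 -> X rOne = 1 -> runs (ifc r c) X X 2.
Proof.
move=> Xr X1; rewrite /runs /ifc size_cat size_map.
apply: (@runs_from_trans _ _ _ 1 X _ _ 1 1).
  by apply: runs_from_step; rewrite //= Xr.
by apply: runs_from_step; rewrite //= X1.
Qed.

Lemma runs_loop v c (I : regs -> Prop) T X :
  (forall X, I X -> X rOne = 1) ->
  (forall X m, I X -> X v = m.+1 ->
     exists X', [/\ runs c [eta X with v |-> m] X' T, I X' & X' v <= m]) ->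
  I X -> exists X', [/\ runs (loop v c) X X' (X v * T.+3 + 2), I X' & X' v = 0].
Proof.
move=> I1 Ibody; move Em: (X v) => m; elim/ltn_ind: m X Em => -[_|m IH] X Em IX.
  exists X; split=> //; rewrite mul0n /runs /loop !size_cat size_map addn1.
  apply: (@runs_from_trans _ _ _ 1 X _ _ 1 1).
    by apply: runs_from_step; rewrite //= Em.
  by apply: runs_from_step; rewrite //= I1.
have [X1 [r1 I1' le_X1]] := Ibody _ _ IX Em.
have [X2 [r2 I2 X2v]] := IH _ le_X1 _ erefl I1'.
exists X2; split=> //.
have le_T : 2 + (T + (1 + (X1 v * T.+3 + 2))) <= m.+1 * T.+3 + 2.
  by rewrite mulSn; have := leq_mul le_X1 (leqnn T.+3); lia.
apply: runs_le le_T _; rewrite /runs.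
apply: (@runs_from_trans _ _ _ 3 [eta X with v |-> m]).
  apply: (@runs_from_trans _ _ _ 2 X _ _ 1 1).
    by apply: runs_from_step; rewrite //= Em.
  by apply: runs_from_step => //=; rewrite Em I1 // subn1.
apply: runs_from_trans (runs_from_embed [:: _; _; _] _ r1) _.
apply: (@runs_from_trans _ _ _ 0 X1 _ _ 1) r2.
apply: (@runs_from_step _ _ _ (IJump rOne 0)); last by rewrite /= (I1 _ I1').
by rewrite /loop !onth_cat /= size_map !add3n !subSS subn0 ltnn subnn.
Qed.

Definition exec_ops (ops : program) (X : regs) : regs :=
  foldl (fun X ins => reg (exec input ins (State 0 X))) X ops.

Lemma reloc_jump_free p ops : all jump_free ops -> map (reloc p) ops = ops.
Proof. by elim: ops => //= -[] //= > IH /IH ->. Qed.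

Lemma runs_ops ops X : all jump_free ops -> runs ops X (exec_ops ops X) (size ops).
Proof.
elim: ops X => [|ins ops IH] X /=; first by move=> _; apply: runs_from_refl.
move=> /andP[free_ins free_ops].
have r1: runs [:: ins] X (reg (exec input ins (State 0 X))) 1.
  by apply: (@runs_from_step _ _ _ ins) => //; case: ins free_ins.
by have := runs_seq r1 (IH _ free_ops); rewrite /seqc /= reloc_jump_free.
Qed.

End Runs.

(** * Formulas with reachability *)

(* Variables are de Bruijn levels: at level [k], [FEx f] binds variable [k] in [f], and
   [FReach i j f] binds [k] and [k.+1] to the ends of a step from variable [i] to variable [j]. *)
Inductive form :=
| FAdj of nat & nat
| FEq of nat & nat
| FNot of form
| FAnd of form & form
| FEx of form
| FReach of nat & nat & form.

Fixpoint depth (f : form) : nat :=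
  match f with
  | FAdj _ _ | FEq _ _ => 0
  | FNot f => depth f
  | FAnd f g => maxn (depth f) (depth g)
  | FEx f => (depth f).+1
  | FReach _ _ f => (depth f).+2
  end.

Fixpoint scoped (k : nat) (f : form) : bool :=
  match f with
  | FAdj i j | FEq i j => (i < k) && (j < k)
  | FNot f => scoped k f
  | FAnd f g => scoped k f && scoped k g
  | FEx f => scoped k.+1 f
  | FReach i j f => [&& i < k, j < k & scoped k.+2 f]
  end.

Section Sat.
Variable G : sgraph.

Fixpoint sat (k : nat) (e : nat -> G) (f : form) : bool :=
  match f with
  | FAdj i j => adj (e i) (e j)
  | FEq i j => e i == e j
  | FNot f => ~~ sat k e f
  | FAnd f g => sat k e f && sat k e g
  | FEx f => [exists x, sat k.+1 [eta e with k |-> x] f]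
  | FReach i j f =>
      connect (fun x y => sat k.+2 [eta e with k |-> x, k.+1 |-> y] f) (e i) (e j)
  end.
End Sat.

(* Variable [k] lives in register [rV k]; [rC k] counts the rounds of an [FReach] at level [k].
   The marks of an [FReach] are the #|G| cells just below the stack pointer [rSp]. *)
Notation rV k := (7 + k.*2).
Notation rC k := (8 + k.*2).

(** The truth value is left in register 0. There is no multiplication, so [FAdj] reaches its entry
    of the adjacency matrix by repeated addition, starting one further because the encoding begins
    with the number of vertices. [FEx] zeroes its counter on success, which ends the loop with
    register 0 still at 1. [FReach] first clears its cells, since earlier evaluations may have left
    marks there. *)
Fixpoint compile (k : nat) (f : form) : program :=
  match f with
  | FAdj i j =>
      seqc [:: IAdd 2 (rV i) rZero; IAdd 1 (rV j) rOne]
        (seqc (loop 2 [:: IAdd 1 1 rN]) [:: IRead 0 1])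
  | FEq i j => [:: ISub 1 (rV i) (rV j); ISub 2 (rV j) (rV i); IAdd 1 1 2; ISub 0 rOne 1]
  | FNot f => seqc (compile k f) [:: ISub 0 rOne 0]
  | FAnd f g => seqc (compile k f) (ifc 0 (compile k g))
  | FEx f =>
      seqc [:: ISet 0 0; IAdd (rV k) rN rZero]
        (loop (rV k) (seqc (compile k.+1 f) (ifc 0 [:: ISet (rV k) 0])))
  | FReach i j f =>
      let mark v := [:: ISub 1 rSp rN; IAdd 1 1 (rV v); IStore 1 rOne] in
      let relax := seqc (compile k.+2 f) (ifc 0 (mark k.+1)) in
      let scan := seqc [:: IAdd (rV k.+1) rN rZero] (loop (rV k.+1) relax) in
      let visit := seqc [:: ISub 1 rSp rN; IAdd 1 1 (rV k); ILoad 0 1] (ifc 0 scan) in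
      let round := seqc [:: IAdd (rV k) rN rZero] (loop (rV k) visit) in
      seqc [:: IAdd rSp rSp rN; IAdd (rV k) rN rZero]
       (seqc (loop (rV k) [:: ISub 1 rSp rN; IAdd 1 1 (rV k); IStore 1 rZero])
       (seqc (mark i)
       (seqc [:: IAdd (rC k) rN rZero]
       (seqc (loop (rC k) round)
       [:: ISub 1 rSp rN; IAdd 1 1 (rV j); ILoad 0 1; ISub rSp rSp rN]))))
  end.

(** * Polynomial bounds and correctness of the compiled code *)

Definition polyb (T : nat -> nat) : Prop := exists C d, forall n, T n <= C * n.+1 ^ d.

Lemma polyb_const c : polyb (fun=> c).
Proof. by exists c, 0 => n; rewrite muln1. Qed.

Lemma polyb_id : polyb id.
Proof. by exists 1, 1 => n; rewrite mul1n expn1. Qed.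

Lemma polyb_add T1 T2 : polyb T1 -> polyb T2 -> polyb (fun n => T1 n + T2 n).
Proof.
move=> [C1 [d1 b1]] [C2 [d2 b2]]; exists (C1 + C2), (d1 + d2) => n.
(* The base [n.+1] is positive, so the exponents can be raised even at [n = 0]. *)
rewrite mulnDl; apply: leq_add; [apply: leq_trans (b1 n) _ | apply: leq_trans (b2 n) _];
  by rewrite leq_mul2l leq_pexp2l ?orbT ?leq_addr ?leq_addl.
Qed.

Lemma polyb_mul T1 T2 : polyb T1 -> polyb T2 -> polyb (fun n => T1 n * T2 n).
Proof.
move=> [C1 [d1 b1]] [C2 [d2 b2]]; exists (C1 * C2), (d1 + d2) => n.
by rewrite expnD mulnACA leq_mul.
Qed.

(** The case of [runs_loop] in which the body leaves the counter alone, so that the invariant can be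
    indexed by it. *)
Lemma runs_for input v c (I : nat -> regs -> Prop) T m X :
  (forall m X, I m X -> X rOne = 1) ->
  (forall X m, I m.+1 X -> X v = m.+1 ->
     exists X', [/\ runs input c [eta X with v |-> m] X' T, I m X' & X' v = m]) ->
  X v = m -> I m X ->
  exists X', [/\ runs input (loop v c) X X' (m * T.+3 + 2), I 0 X' & X' v = 0].
Proof.
move=> I1 Ibody <- IX.
have [Y m0 IY Yv|X' [r IX' X'v]] :=
    @runs_loop input v c (fun X => I (X v) X) T X (fun X => I1 _ X) _ IX.
  move: IY; rewrite Yv => IY; have [Y' [r' IY' Y'v]] := Ibody _ _ IY Yv.
  by exists Y'; rewrite Y'v.
by move: IX'; rewrite X'v => IX'; exists X'.
Qed.

Lemma sat_ext (G : sgraph) (f : form) k (e e' : nat -> G) :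
  scoped k f -> (forall i, i < k -> e i = e' i) -> sat k e f = sat k e' f.
Proof.
elim: f k e e' => [i j|i j|f IH|f IHf g IHg|f IH|i j f IH] k e e' /=.
- by move=> /andP[lt_i lt_j] ee'; rewrite !ee'.
- by move=> /andP[lt_i lt_j] ee'; rewrite !ee'.
- by move=> sf ee'; rewrite (IH _ e e').
- by move=> /andP[sf sg] ee'; rewrite (IHf _ e e') // (IHg _ e e').
- move=> sf ee'; apply: eq_existsb => x; apply: IH => // i lt_i /=.
  by case: eqP => // ne; apply: ee'; lia.
- move=> /and3P[lt_i lt_j sf] ee'; rewrite !ee' //; apply: eq_connect => x y.
  apply: IH => // l lt_l /=; case: eqP => // ne; case: eqP => // ne'.
  by apply: ee'; lia.
Qed.

(* [B] bounds the statically allocated registers; the stack of marks starts there. *)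
Section Correctness.
Variable B : nat.

(** What code at level [k] must preserve: the constants, the stack pointer, the variables and
    counters of the outer levels, and the marks of the enclosing [FReach] operators. Everything else
    is free for its use. *)
Definition kept (k sp j : nat) : bool := (3 <= j < 7 + k.*2) || (B <= j < sp).

Definition frame (k : nat) (X X' : regs) : Prop := forall j, kept k (X rSp) j -> X' j = X j.

Definition holds_env (G : sgraph) (k : nat) (e : nat -> G) (X : regs) : Prop :=
  [/\ X rN = #|G|, X rOne = 1, X rZero = 0, B <= X rSp
    & forall i, i < k -> X (rV i) = enum_rank (e i)].

Lemma frame_trans k X Y Z : frame k X Y -> frame k Y Z -> frame k X Z.
Proof.
by move=> fXY fYZ j kj; rewrite -(fXY _ kj) fYZ // (fXY rSp).
Qed.

Lemma frame_le k k' X Y : k <= k' -> frame k' X Y -> frame k X Y.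
Proof. by move=> le_k f j kj; apply: f; move: kj; rewrite /kept; lia. Qed.

Lemma holds_env_frame (G : sgraph) k (e : nat -> G) X Y :
  holds_env k e X -> frame k X Y -> holds_env k e Y.
Proof.
move=> [XN X1 X0 Xsp Xe] f; split; try by rewrite f // /kept; lia.
by move=> i lt_i; rewrite f ?Xe // /kept; lia.
Qed.

Lemma holds_env_extend (G : sgraph) k (e : nat -> G) x X :
  holds_env k e X -> X (rV k) = enum_rank x -> holds_env k.+1 [eta e with k |-> x] X.
Proof.
move=> [XN X1 X0 Xsp Xe] Xk; split=> // i lt_i /=; case: eqP => [->//|ne].
by apply: Xe; lia.
Qed.

Lemma nth_allpairs (T S : Type) (s : seq T) (t : seq S) (g : T -> S -> nat) x0 y0 i j :
  i < size s -> j < size t ->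
  nth 0 [seq g x y | x <- s, y <- t] (i * size t + j) = g (nth x0 s i) (nth y0 t j).
Proof.
move=> + lt_j; elim: s i => // x s IH [|i] lt_i /=; rewrite nth_cat size_map.
  by rewrite mul0n lt_j (nth_map y0).
by rewrite mulSn -addnA ltnNge leq_addr addKn IH.
Qed.

Lemma nth_encode (G : sgraph) (x y : G) :
  nth 0 (encode G) (enum_rank y + 1 + enum_rank x * #|G|) = adj x y.
Proof.
rewrite addn1 addSn /= addnC; set i := enum_rank x; set j := enum_rank y.
have := @nth_allpairs _ _ (enum G) (enum G) (fun x y => adj x y) x y i j.
by rewrite -cardE !ltn_ord !nth_enum_rank => ->.
Qed.

Definition compiles (f : form) (k : nat) : Prop :=
  exists2 T, polyb T & forall (G : sgraph) (e : nat -> G) X, holds_env k e X ->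
    exists X', [/\ runs (encode G) (compile k f) X X' (T #|G|), frame k X X'
      & X' 0 = sat k e f].

Lemma polyb_S T : polyb T -> polyb (fun n => (T n).+1).
Proof. by move=> /(polyb_add (polyb_const 1)). Qed.

Ltac polyb_tac :=
  repeat first [exact: polyb_const | exact: polyb_id | assumption
               | apply: polyb_add | apply: polyb_mul | apply: polyb_S].
Ltac regs_tac := rewrite /= /kept; repeat (case: eqP => ? /=); try lia.

Lemma compiles_adj i j k : rV k <= B -> i < k -> j < k -> compiles (FAdj i j) k.
Proof.
move=> le_B lt_i lt_j; exists (fun n => 2 + ((n * 4 + 2) + 1)).
  by polyb_tac.
move=> G e X eX; have [XN X1 X0 Xsp Xe] := eX.
pose ops := [:: IAdd 2 (rV i) rZero; IAdd 1 (rV j) rOne].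
have fops: frame k X (exec_ops (encode G) ops X) by move=> l; rewrite /ops; regs_tac.
(* Register 1 approaches the index of the matrix entry, with [m] additions still to come. *)
pose I m Y := [/\ frame k X Y & Y 1 + m * #|G| = enum_rank (e j) + 1 + enum_rank (e i) * #|G|].
have [||||Y [rY [fY Y1 _]]] := @runs_for (encode G) 2 [:: IAdd 1 1 rN] I 1
    (enum_rank (e i)) (exec_ops (encode G) ops X).
- by move=> m Y [f _]; rewrite f // /kept; lia.
- move=> Y m [f Y1] Y2; eexists; split; first exact: runs_ops.
    split=> [l kl|]; last first.
      by rewrite /= -[RHS]Y1 (f rN) // XN mulSn addnA.
    by rewrite -f //; move: kl; regs_tac.
  by [].
- by rewrite /= Xe // X0 addn0.
- split=> //.
  by rewrite /= Xe // X1.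
exists (exec_ops (encode G) [:: IRead 0 1] Y); split.
- have lt_r: enum_rank (e i) * 4 + 2 <= #|G| * 4 + 2 by rewrite leq_add2r leq_mul2r ltnW.
  apply: runs_seq; first exact: runs_ops.
  by apply: runs_seq (runs_le lt_r rY) _; exact: runs_ops.
- by apply: frame_trans fY _ => l; regs_tac.
- by rewrite /= -nth_encode -Y1 mul0n addn0.
Qed.

Lemma compiles_eq i j k : rV k <= B -> i < k -> j < k -> compiles (FEq i j) k.
Proof.
move=> le_B lt_i lt_j; exists (fun=> 4); first exact: polyb_const.
move=> G e X [XN X1 X0 Xsp Xe]; eexists; split; first exact: runs_ops.
  by move=> l; regs_tac.
rewrite /= X1; repeat (case: eqP; [lia | move=> _]); rewrite !Xe //.
have -> : (e i == e j) = (enum_rank (e i) == enum_rank (e j)).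
  by apply/eqP/eqP => [->|/enum_rank_inj].
by rewrite -(inj_eq val_inj) /=; case: eqP => /=; lia.
Qed.

Lemma compiles_not f k : rV k <= B -> compiles f k -> compiles (FNot f) k.
Proof.
move=> le_B [T bT run_f]; exists (fun n => T n + 1); first by polyb_tac.
move=> G e X eX; have [Y [rY fY Y0]] := run_f _ _ _ eX.
have [_ Y1 _ _ _] := holds_env_frame eX fY.
eexists; split; first by apply: runs_seq rY _; exact: runs_ops.
  by apply: frame_trans fY _ => l; regs_tac.
by rewrite /= Y1 Y0; case: sat.
Qed.

Lemma compiles_and f g k : rV k <= B -> compiles f k -> compiles g k -> compiles (FAnd f g) k.
Proof.
move=> le_B [T bT run_f] [T' bT' run_g]; exists (fun n => T n + (T' n + 2)).
  by polyb_tac.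
move=> G e X eX; have [Y [rY fY Y0]] := run_f _ _ _ eX.
have eY := holds_env_frame eX fY; have [_ Y1 _ _ _] := eY.
case s_f: (sat k e f) Y0 => Y0 /=; last first.
  exists Y; split; rewrite ?s_f //; apply: runs_seq rY _.
  by apply: runs_le (leq_addl _ _) _; apply: runs_if_false.
have [Z [rZ fZ Z0]] := run_g _ _ _ eY.
exists Z; split; rewrite ?s_f //; last exact: frame_trans fZ.
apply: runs_seq rY _; rewrite addn2; apply: runs_le (leqnSn _) _.
by apply: runs_if_true rZ; rewrite Y0.
Qed.

Lemma compiles_ex f k : rV k.+1 <= B -> compiles f k.+1 -> compiles (FEx f) k.
Proof.
move=> le_B [T bT run_f]; exists (fun n => 2 + (n * (T n + 5) + 2)).
  by polyb_tac.
move=> G e X eX; have [XN X1 X0 Xsp Xe] := eX.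
pose v := rV k; pose P x := sat k.+1 [eta e with k |-> x] f.
pose ops := [:: ISet 0 0; IAdd v rN rZero].
(* Either all vertices from the counter upwards have failed, or a witness was found and the counter
   was zeroed to stop the search. *)
pose I Y := frame k X Y /\
  ([/\ Y 0 = 0, Y v <= #|G| & forall x, Y v <= enum_rank x -> ~~ P x]
   \/ [/\ Y 0 = 1, Y v = 0 & exists x, P x]).
have [|||Y [rY [fY IY] Yv]] := @runs_loop (encode G) v (seqc (compile k.+1 f) (ifc 0 [:: ISet v 0])) I
    (T #|G| + 2) (exec_ops (encode G) ops X).
- by move=> Y [fY _]; rewrite fY // /kept; lia.
- move=> Y m [fY [[Y0 le_v Yno]|[_ -> _]]] // Yv.
  have lt_m: m < #|G| by rewrite -Yv.
  pose x := enum_val (Ordinal lt_m).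
  have fY': frame k X [eta Y with v |-> m].
    by apply: frame_trans fY _ => j; rewrite /v; regs_tac.
  have eY: holds_env k.+1 [eta e with k |-> x] [eta Y with v |-> m].
    apply: holds_env_extend; first exact: holds_env_frame fY'.
    by rewrite /= eqxx enum_valK.
  have [Z [rZ fZ Z0]] := run_f _ _ _ eY; have [_ Z1 _ _ _] := holds_env_frame eY fZ.
  have fXZ: frame k X Z by apply: frame_trans fY' (frame_le _ fZ).
  have Zv: Z v = m by rewrite fZ /= ?eqxx // /kept /v; lia.
  case Px: (P x); move: Z0; rewrite -/(P x) Px => Z0.
    exists (exec_ops (encode G) [:: ISet v 0] Z); split.
    + by apply: runs_seq rZ _; apply: runs_if_true; [rewrite Z0 | exact: runs_ops].
    + split; first by apply: frame_trans fXZ _ => j; rewrite /v; regs_tac.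
      by right; split; rewrite /= ?eqxx //; exists x.
    + by rewrite /= eqxx.
  exists Z; split; rewrite ?Zv //.
    by apply: runs_seq rZ _; apply: runs_if_false.
  split=> //; left; rewrite Zv; split=> // [|y]; first exact: ltnW.
  rewrite leq_eqVlt => /orP[/eqP my | lt_my]; last by apply: Yno; rewrite Yv.
  suff -> : y = x by rewrite Px.
  by apply: enum_rank_inj; rewrite enum_valK; apply: val_inj.
- split; first by move=> j; rewrite /v; regs_tac.
  left; rewrite /= eqxx XN X0 addn0; split=> // x.
  by rewrite leqNgt ltn_ord.
exists Y; split=> //.
  apply: runs_seq; first exact: runs_ops.
  by move: rY; rewrite /= eqxx XN X0 addn0 -addn3 -addnA.
case: IY => [[-> _]|[-> _ exP]]; rewrite /=.
  rewrite Yv => noP; case: existsP => // -[x Px].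
  by have := noP x (leq0n _); rewrite /P Px.
by case: existsP => // noP; case: noP; case: exP => x; exists x.
Qed.

(** Only reachable vertices are ever marked, and a round that adds no mark has found a closed set.
    Since there are only [n] vertices, [n] rounds suffice. *)
Lemma compiles_reach i j f k : rV k.+2 <= B -> i < k -> j < k ->
  compiles f k.+2 -> compiles (FReach i j f) k.
Proof.
move=> le_B lt_i lt_j [T bT run_f].
pose relaxT n := T n + 4.
pose scanT n := 1 + (n * (relaxT n).+3 + 2).
pose visitT n := 3 + (scanT n).+1.
pose roundT n := 1 + (n * (visitT n).+3 + 2).
exists (fun n => 2 + ((n * 6 + 2) + (3 + (1 + ((n * (roundT n).+3 + 2) + 4))))).
  by rewrite /roundT /visitT /scanT /relaxT; polyb_tac.
move=> G e X eX; have [XN X1 X0 Xsp Xe] := eX.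
set n := #|G| in XN *; set sp := X rSp in Xsp.
have lt_rank (z : G) : enum_rank z < n by apply: ltn_ord.
pose r x y := sat k.+2 [eta e with k |-> x, k.+1 |-> y] f.
(* With the stack pointer raised by [n], the marks lie below it and the code of [f] must preserve
   them. [base] lists what the whole operator must preserve, with the stack pointer still raised;
   the last instruction lowers it again. *)
pose Z := [eta X with rSp |-> sp + n].
pose base (Y : regs) := forall l, kept k sp l -> Y l = Z l.
pose cells (Y : regs) (M : {set G}) := forall x, Y (sp + enum_rank x) = (x \in M).
have baseP Y : base Y ->
    [/\ Y rN = n, Y rOne = 1, Y rZero = 0, Y rSp = sp + n
      & forall l, l < k -> Y (rV l) = enum_rank (e l)].
  move=> bY; do ![rewrite bY ?/kept; last lia]; split=> // l lt_l.
  by rewrite bY /Z /kept; [rewrite /= Xe | lia].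
pose mark v := [:: ISub 1 rSp rN; IAdd 1 1 (rV v); IStore 1 rOne].
pose relax := seqc (compile k.+2 f) (ifc 0 (mark k.+1)).
pose scan := seqc [:: IAdd (rV k.+1) rN rZero] (loop (rV k.+1) relax).
pose visit := seqc [:: ISub 1 rSp rN; IAdd 1 1 (rV k); ILoad 0 1] (ifc 0 scan).
pose round := seqc [:: IAdd (rV k) rN rZero] (loop (rV k) visit).
have markP v Y M y : base Y -> cells Y M -> Y (rV v) = enum_rank y ->
    let Y' := exec_ops (encode G) (mark v) Y in
    [/\ base Y', cells Y' (y |: M) & forall l, 3 <= l < B -> Y' l = Y l].
  move=> bY cY Yv; have [YN Y1 Y0 Ysp _] := baseP _ bY.
  rewrite /mark /= Ysp YN addnK Yv Y1; split.
  - by move=> l kl; rewrite -bY //; move: kl; have := lt_rank y; regs_tac.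
  - move=> x; rewrite /= !inE eqn_add2l (inj_eq val_inj) (inj_eq enum_rank_inj).
    by case: eqP => //= _; case: eqP => [|_]; [lia | rewrite cY].
  - by move=> l; regs_tac.
have vary Y v m : base Y -> rV k <= v < B -> base [eta Y with v |-> m].
  by move=> bY lt_v l kl; rewrite -bY //; move: kl; regs_tac.
have vary_cells Y M v m : cells Y M -> v < B -> cells [eta Y with v |-> m] M.
  by move=> cY lt_v x; rewrite -cY; regs_tac.
have relaxP Y M x y : base Y -> cells Y M -> Y (rV k) = enum_rank x ->
    Y (rV k.+1) = enum_rank y -> exists Y',
    [/\ runs (encode G) relax Y Y' (relaxT n), base Y',
        cells Y' (M :|: [set z | (z == y) && r x z])
      & forall l, 3 <= l < rV k.+2 -> Y' l = Y l].
  move=> bY cY Yx Yy; have [YN Y1 Y0 Ysp Ye] := baseP _ bY.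
  have [|Y' [rY' fY' Y'0]] := run_f _ [eta e with k |-> x, k.+1 |-> y] Y.
    split=> //; first by rewrite Ysp; lia.
    move=> l lt_l /=; case: eqP => [->//|ne]; case: eqP => [->//|ne'].
    by apply: Ye; lia.
  have bY' : base Y'.
    by move=> l kl; rewrite -bY // fY' //; move: kl; rewrite Ysp /kept; lia.
  have cY' : cells Y' M.
    by move=> z; rewrite -cY fY' // Ysp /kept; have := lt_rank z; lia.
  have kY' l : 3 <= l < rV k.+2 -> Y' l = Y l by move=> ll; rewrite fY' // /kept ll.
  case rxy: (r x y); move: Y'0; rewrite -/(r x y) rxy => Y'0; last first.
    exists Y'; split=> //.
      apply: runs_seq rY' _; apply: (@runs_le _ _ _ _ 2) => //.
      by apply: runs_if_false => //; rewrite kY'.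
    suff -> : [set z | (z == y) && r x z] = set0 by rewrite setU0.
    by apply/setP=> z; rewrite !inE; case: eqP => // ->.
  have [|bY'' cY'' kY''] := markP k.+1 _ _ y bY' cY'; first by rewrite kY' // /kept; lia.
  exists (exec_ops (encode G) (mark k.+1) Y'); split=> //.
  - apply: runs_seq rY' _; apply: runs_if_true; first by rewrite Y'0.
    exact: runs_ops.
  - suff -> : M :|: [set z | (z == y) && r x z] = y |: M by [].
    by apply/setP=> z; rewrite !inE orbC; case: eqP => [->|//]; rewrite rxy.
  - by move=> l ll; rewrite kY'' ?kY' //; lia.
have scanP Y M x : base Y -> cells Y M -> Y (rV k) = enum_rank x -> exists Y',
    [/\ runs (encode G) scan Y Y' (scanT n), base Y', cells Y' (M :|: [set z | r x z])
      & forall l, 3 <= l <= rC k -> Y' l = Y l].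
  move=> bY cY Yx; have [YN Y1 Y0 _ _] := baseP _ bY.
  pose I m Y' := [/\ m <= n, base Y', cells Y' (M :|: [set z | (m <= enum_rank z) && r x z])
    & forall l, 3 <= l <= rC k -> Y' l = Y l].
  pose ops := [:: IAdd (rV k.+1) rN rZero].
  have [||||Y' [rY' [_ bY' cY' kY'] _]] := @runs_for (encode G) (rV k.+1) relax I (relaxT n) n
      (exec_ops (encode G) ops Y).
  - by move=> m Y' [_ /baseP[]].
  - move=> Y' m [lt_m bY' cY' kY'] Y'v.
    pose y := enum_val (Ordinal lt_m).
    have [||||Y'' [rY'' bY'' cY'' kY'']] := relaxP [eta Y' with rV k.+1 |-> m]
        (M :|: [set z | (m < enum_rank z) && r x z]) x y.
    + by apply: vary => //; lia.
    + by apply: vary_cells => //; lia.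
    + by rewrite -Yx -kY'; regs_tac.
    + by rewrite /= eqxx enum_valK.
    exists Y''; split=> //; last by rewrite kY'' /= ?eqxx //; lia.
    split; rewrite // 1?ltnW //.
    + move=> z; rewrite cY'' !inE -orbA -andb_orl; congr (nat_of_bool (_ || (_ && _))).
      rewrite [RHS]leq_eqVlt orbC -[m]/(nat_of_ord (Ordinal lt_m)) (inj_eq val_inj).
      by rewrite -(inj_eq enum_val_inj) enum_rankK eq_sym.
    + by move=> l ll; rewrite -kY' // kY''; regs_tac.
  - by rewrite /= eqxx YN Y0 addn0.
  - split=> //.
    + by apply: vary => //; lia.
    + by move=> z; rewrite !inE leqNgt lt_rank orbF -cY /ops; regs_tac.
    + by move=> l; rewrite /ops; regs_tac.
  exists Y'; split=> //.
  by apply: runs_seq rY'; exact: runs_ops.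
pose Rc := [set x | connect r (e i) x].
(* A mark made during a round may already be used in the same round, so the new set is only bounded:
   it contains the successors of [M] and consists of reachable vertices. *)
have roundP Y M : base Y -> cells Y M -> M \subset Rc -> exists Y' M',
    [/\ runs (encode G) round Y Y' (roundT n), base Y', cells Y' M'
      & Y' (rC k) = Y (rC k)] /\
    [/\ M \subset M', M' \subset Rc & forall x y, x \in M -> r x y -> y \in M'].
  move=> bY cY sM; have [YN Y1 Y0 _ _] := baseP _ bY.
  pose I m Y' := [/\ m <= n, base Y', Y' (rC k) = Y (rC k) & exists M', [/\ cells Y' M',
    M \subset M', M' \subset Rc
    & forall x y, x \in M -> m <= enum_rank x -> r x y -> y \in M']].
  pose ops := [:: IAdd (rV k) rN rZero].
  have [||||Y' [rY' [_ bY' kY' [M' [cY' sMM' sM' closM']]] _]] :=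
      @runs_for (encode G) (rV k) visit I (visitT n) n (exec_ops (encode G) ops Y).
  - by move=> m Y' [_ /baseP[]].
  - move=> Y' m [lt_m bY' kY' [M' [cY' sMM' sM' closM']]] Y'v.
    pose x := enum_val (Ordinal lt_m).
    have Ex z : z != x -> (m <= enum_rank z) = (m < enum_rank z).
      move=> ne; rewrite leq_eqVlt -[m]/(nat_of_ord (Ordinal lt_m)) (inj_eq val_inj).
      by rewrite -(inj_eq enum_val_inj) enum_rankK eq_sym (negbTE ne).
    pose Y1' := [eta Y' with rV k |-> m].
    pose Y2 := exec_ops (encode G) [:: ISub 1 rSp rN; IAdd 1 1 (rV k); ILoad 0 1] Y1'.
    have bY1: base Y1' by apply: vary => //; lia.
    have bY2: base Y2 by move=> l kl; rewrite -bY1 //; move: kl; rewrite /Y2; regs_tac.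
    have [Y'N Y'1 Y'0 Y'sp _] := baseP _ bY'.
    have cY1: cells Y1' M' by apply: vary_cells => //; lia.
    have cY2: cells Y2 M' by move=> z; rewrite -cY1 /Y2; regs_tac.
    have Y2_0 : Y2 0 = (x \in M').
      rewrite -cY1 enum_valK /Y2 /= Y'sp Y'N eqxx addnK.
      by repeat (case: eqP => ? //=; try lia).
    have Y2x : Y2 (rV k) = m by rewrite /Y2 /Y1' /= eqxx.
    have Y2C : Y2 (rC k) = Y (rC k) by rewrite -kY' /Y2 /Y1'; regs_tac.
    have Y2_1 : Y2 rOne = 1 by have [] := baseP _ bY2.
    case xM': (x \in M') Y2_0 => Y2_0; last first.
      exists Y2; split=> //.
        apply: runs_seq; first exact: runs_ops.
        by apply: (@runs_le _ _ _ _ 2) => //; apply: runs_if_false.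
      split=> //; first exact: ltnW.
      exists M'; split=> // z y zM; rewrite Ex; first exact: closM'.
      by apply: contraFneq xM' => <-; apply: (subsetP sMM').
    have [|Y3 [rY3 bY3 cY3 kY3]] := scanP Y2 M' x bY2 cY2; first by rewrite enum_valK.
    exists Y3; split.
    + apply: (@runs_seq _ _ _ _ Y2); first exact: runs_ops.
      by apply: runs_if_true rY3; rewrite Y2_0.
    + split=> //; [exact: ltnW | by rewrite kY3 ?Y2C //; lia |].
      exists (M' :|: [set z | r x z]); split=> //.
      * by rewrite (subset_trans sMM') // subsetUl.
      * rewrite subUset sM'; apply/subsetP=> z; rewrite !inE => rxz.
        have := subsetP sM' _ xM'; rewrite inE => /connect_trans; apply.
        exact: connect1.
      * move=> z y zM; have [->|ne] := eqVneq z x; first by rewrite !inE => _ ->; rewrite orbT.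
        by rewrite Ex // !inE => lt_z rzy; rewrite (closM' z).
    + by rewrite kY3 //; lia.
  - by rewrite /= eqxx YN Y0 addn0.
  - split=> //; first by apply: vary => //; lia.
      by regs_tac.
    exists M; split=> // [|x y _]; last by rewrite leqNgt ltn_ord.
    by apply: vary_cells => //; lia.
  exists Y', M'; split; split=> //; last by move=> x y xM; apply: closM'.
  by apply: runs_seq; first exact: runs_ops.
pose Xa := exec_ops (encode G) [:: IAdd rSp rSp rN; IAdd (rV k) rN rZero] X.
pose zero := [:: ISub 1 rSp rN; IAdd 1 1 (rV k); IStore 1 rZero].
have bXa: base Xa by move=> l; rewrite /Xa /Z /sp -XN; regs_tac.
pose Iz m Y := [/\ m <= n, base Y & forall x : G, m <= enum_rank x -> Y (sp + enum_rank x) = 0].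
have [||||Xb [rXb [_ bXb zXb] _]] := @runs_for (encode G) (rV k) zero Iz 3 n Xa.
- by move=> m Y [_ /baseP[]].
- move=> Y m [lt_m bY zY] Ym; have [YN Y1 Y0 Ysp _] := baseP _ bY.
  eexists; split; first exact: runs_ops.
    split; first exact: ltnW.
      move=> l kl; rewrite -bY //= Ysp YN eqxx addnK Y0; move: kl.
      by have := lt_m; rewrite /n; regs_tac.
    move=> x; rewrite /= Ysp YN eqxx addnK Y0; case: (eqVneq (sp + _)) => //= ne le_m.
    have lt_m' : m < enum_rank x.
      by rewrite ltn_neqAle le_m andbT; apply: contra_neq ne => ->.
    by have := zY x lt_m'; regs_tac.
  by rewrite /= Ysp YN eqxx addnK; regs_tac.
- by rewrite /Xa /= eqxx XN X0 addn0.
- by split=> // x; rewrite leqNgt ltn_ord.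
have cXb: cells Xb set0 by move=> x; rewrite zXb // inE.
have [|bXc cXc _] := markP i Xb set0 (e i) bXb cXb.
  by have [_ _ _ _ ->] := baseP _ bXb.
set Xc := exec_ops _ _ _ in bXc cXc.
pose Xd := exec_ops (encode G) [:: IAdd (rC k) rN rZero] Xc.
have [XcN _ Xc0 _ _] := baseP _ bXc.
(* Marks plus remaining rounds exceed [n] until the set is complete. One mark and [n] rounds start
   this; when no round remains, only completeness is possible. *)
pose I m Y := base Y /\ exists M, [/\ cells Y M, e i \in M, M \subset Rc
  & n < #|M| + m \/ Rc \subset M].
have [||||Xe' [rXe [bXe [M [cXe iM sM closM]]] _]] :=
    @runs_for (encode G) (rC k) round I (roundT n) n Xd.
- by move=> m Y [/baseP[]].
- move=> Y m [bY [M [cY iM sM closM]]] Ym.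
  have [||Y' [M' [[rY' bY' cY' Y'C] [sMM' sM' closM']]]] :=
    roundP [eta Y with rC k |-> m] M _ _ sM.
  + by apply: vary => //; lia.
  + by apply: vary_cells => //; lia.
  exists Y'; split; rewrite ?Y'C /= ?eqxx //; split=> //.
  exists M'; split=> //; first exact: (subsetP sMM').
  (* A round without a new mark shows that [M] is closed under [r], so every path from [e i] stays
     in it; otherwise the number of marks grows and pays for the round. *)
  have [eqM|neM] := eqVneq M M'.
    right; apply/subsetP=> x; rewrite inE -eqM => /connectP[p].
    elim: p (e i) iM => [|z p IHp] y yM /=; first by move=> _ ->.
    by move=> /andP[ryz]; apply: IHp; rewrite eqM; apply: closM' ryz.
  case: closM => [lt_n|closM]; last by right; apply: subset_trans sMM'.
  left; apply: leq_trans lt_n _; rewrite addnS ltn_add2r.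
  by apply: proper_card; rewrite properEneq neM.
- by rewrite /Xd /= eqxx XcN Xc0 addn0.
- split; first by apply: vary => //; lia.
  exists [set e i]; split; rewrite ?inE ?eqxx // ?sub1set ?inE ?connect0 //.
    by move: cXc; rewrite setU0 => cXc; apply: vary_cells => //; lia.
  by left; rewrite cards1 add1n.
have eM : M = Rc.
  apply/eqP; rewrite eqEsubset sM; case: closM => // lt_n.
  by have := max_card M; rewrite leqNgt -[#|M|]addn0 lt_n.
have [YN Y1 _ Ysp Ye] := baseP _ bXe.
pose fin := [:: ISub 1 rSp rN; IAdd 1 1 (rV j); ILoad 0 1; ISub rSp rSp rN].
exists (exec_ops (encode G) fin Xe'); split.
- apply: (@runs_seq _ _ _ _ Xa); first exact: runs_ops.
  apply: runs_seq rXb _.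
  apply: (@runs_seq _ _ _ _ Xc); first exact: runs_ops.
  apply: (@runs_seq _ _ _ _ Xd); first exact: runs_ops.
  by apply: runs_seq rXe _; exact: runs_ops.
- move=> l kl; rewrite /fin /= Ysp YN addnK; case: eqP => [-> //|ne_sp].
  by have := bXe _ kl; move: kl; rewrite /Z; regs_tac.
- rewrite /fin /= Ysp YN Ye // addnK.
  by have := cXe (e j); rewrite eM inE; regs_tac.
Qed.

Lemma compile_correct f k : scoped k f -> rV (k + depth f) <= B -> compiles f k.
Proof.
elim: f k => [i j|i j|f IH|f IHf g IHg|f IH|i j f IH] k /=.
- by rewrite addn0 => /andP[lt_i lt_j] le_B; apply: compiles_adj.
- by rewrite addn0 => /andP[lt_i lt_j] le_B; apply: compiles_eq.
- by move=> sf le_B; apply: compiles_not; [lia | apply: IH].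
- move=> /andP[sf sg] le_B.
  by apply: compiles_and; [lia | apply: IHf | apply: IHg] => //; lia.
- by move=> sf le_B; apply: compiles_ex; [lia | apply: IH => //; lia].
- move=> /and3P[lt_i lt_j sf] le_B.
  by apply: compiles_reach => //; [lia | apply: IH => //; lia].
Qed.

End Correctness.

(** The empty graph has no environment, so the code of [f] is skipped and register 0 keeps its 0.
    For other graphs [n + 1 <= 2 * n] turns the bound into one in [n], whence the factor [2 ^ d];
    the 5 pays for the three initial instructions and the test. *)
Theorem form_poly_time (f : form) :
  scoped 0 f -> poly_time_decidable (fun G => exists e : nat -> G, sat 0 e f).
Proof.
move=> sf; have [T [C [d bT]] run_f] := compile_correct sf (leqnn (rV (0 + depth f))).
set B := rV _ in run_f.
pose init := [:: ISet rOne 1; ISet rSp B; IRead rN rZero].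
exists (seqc init (ifc rN (compile 0 f))), (C * 2 ^ d + 5), d => G.
pose X0 := exec_ops (encode G) init (fun=> 0).
suff [X r X0P]: exists2 X, runs (encode G) (seqc init (ifc rN (compile 0 f))) (fun=> 0) X
      ((C * 2 ^ d + 5) * #|G| ^ d + (C * 2 ^ d + 5))
    & X 0 != 0 <-> exists e : nat -> G, sat 0 e f.
  by case: r => t le_t e_t; exists t => //; rewrite /run /accepting /halted e_t /= leqnn.
case: (posnP #|G|) => [G0|G_gt0].
  exists X0; last by split=> // -[e _]; have := fintype0 (e 0); rewrite G0.
  apply: (@runs_le _ _ _ _ 5); first by lia.
  apply: (@runs_seq _ _ _ _ X0 _ 3 2); first exact: runs_ops.
  by apply: runs_if_false; rewrite /X0 /= ?G0.
have /card_gt0P[x0 _] := G_gt0.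
(* At level 0 no register holds a variable, so a constant environment serves; by [sat_ext] it is as
   good as any other. *)
have [|X [rX _ X0v]] := run_f G (fun=> x0) X0; first by split=> //=; lia.
exists X.
  apply: (@runs_le _ _ _ _ (3 + (T #|G|).+1)).
    have le_pow : #|G|.+1 ^ d <= 2 ^ d * #|G| ^ d.
      by rewrite -expnMn; case: (d) => // d'; rewrite leq_exp2r //; lia.
    have := leq_trans (bT _) (leq_mul (leqnn C) le_pow); rewrite mulnA.
    by rewrite mulnDl; lia.
  apply: (@runs_seq _ _ _ _ X0 _ 3); first exact: runs_ops.
  exact: runs_if_true rX.
rewrite X0v; split=> [|[e]]; first by case s0: sat => // _; exists (fun=> x0).
by rewrite (sat_ext (e' := fun=> x0) sf) // => ->.
Qed.

(** * Thetas *)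

Section InducedPaths.
Variables (T : eqType) (e : rel T).

(** The vertices of [s], in this order, form an induced path. The default of [head] is never
    reached, since [all] ranges over the same tail. *)
Fixpoint ipath (s : seq T) : bool :=
  if s is x :: s' then
    [&& x \notin s', all (fun y => e x y == (y == head x s')) s' & ipath s']
  else true.

(** Disjoint and anticomplete, in the usual terminology. *)
Definition anti (s t : seq T) : Prop := {in s & t, forall x y, x != y /\ ~~ e x y}.

(* [s] and [t] meet exactly in the edge from the last vertex of [s] to the first of [t]. *)
Definition joined (s t : seq T) : Prop :=
  {in s & t, forall x y, x != y /\ e x y = (x == last x s) && (y == head y t)}.

Lemma ipath_cons x s :
  reflect [/\ x \notin s, {in s, forall y, e x y = (y == head x s)} & ipath s] (ipath (x :: s)).
Proof.
apply: (iffP and3P) => -[xs es ips]; split=> //; first by move=> y /(allP es)/eqP.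
by apply/allP=> y /es ->.
Qed.

Lemma ipath_cat s t : ipath (s ++ t) <-> [/\ ipath s, ipath t & joined s t].
Proof.
elim: s => [|x s IH] /=; first by split=> [it|[]//]; split=> // x y.
rewrite -/(ipath (x :: (s ++ t))) -/(ipath (x :: s)); split.
  move=> /ipath_cons[+ es /IH[ips it jst]]; rewrite mem_cat negb_or => /andP[xs xt].
  split=> //.
    apply/ipath_cons; split=> // y ys; rewrite es ?mem_cat ?ys //.
    by case: (s) ys.
  move=> y z; rewrite inE => /orP[/eqP->{y}|ys] zt.
    split; first by apply: contraNneq xt => ->.
    rewrite es ?mem_cat ?zt ?orbT //; case: (s) xs jst => [|y s'] xs jst /=.
      by rewrite eqxx; case: (t) zt.
    rewrite [x == _](negbTE _); last by apply: contraNneq xs => ->; apply: mem_last.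
    by apply/negbTE; rewrite eq_sym; have [] := jst y z (mem_head _ _) zt.
  by have [ne ->] := jst _ _ ys zt; split=> //; case: (s) ys.
move=> [/ipath_cons[xs es ips] it jst].
apply/ipath_cons; split.
- rewrite mem_cat negb_or xs; apply/negP=> xt.
  by have [] := jst x x (mem_head _ _) xt; rewrite eqxx.
- move=> y; rewrite mem_cat => /orP[ys|yt].
    by rewrite es //; case: (s) ys.
  have [ne ->] := jst x y (mem_head _ _) yt.
  case: (s) xs jst => [|z s'] xs jst /=; first by rewrite eqxx; case: (t) yt.
  rewrite [x == _](negbTE _); last by apply: contraNneq xs => ->; apply: mem_last.
  by apply/esym/negbTE; rewrite eq_sym; have [] // := jst z y _ yt; rewrite !inE eqxx orbT.
- apply/IH; split=> // y z ys zt; have [|ne ->] := jst y z _ zt; first by rewrite inE ys orbT.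
  by split=> //; case: (s) ys.
Qed.

Hypothesis e_sym : symmetric e.

Lemma ipath_rev s : ipath (rev s) = ipath s.
Proof.
suff imp t : ipath t -> ipath (rev t) by apply/idP/idP => /imp; rewrite ?revK.
elim: t => //= x t IH; rewrite -/(ipath (x :: t)) => /ipath_cons[xt et it].
rewrite rev_cons -cats1; apply/ipath_cat; split=> //; first exact: IH.
move=> y z; rewrite mem_rev inE => yt /eqP->{z} /=; rewrite eqxx andbT e_sym et //.
split; first by apply: contraNneq xt => <-.
by case: (t) yt => // z t' _; rewrite rev_cons last_rcons.
Qed.

Lemma anti_sym s t : anti s t -> anti t s.
Proof. by move=> a x y xt ys; rewrite e_sym eq_sym; apply: a. Qed.

(** Each arm is tested without [d] and without [a] separately: another arm may be empty, and then
    [a] and [d] are adjacent and [a :: rcons p d] is not induced. *)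
Definition theta (a d : T) (p q r : seq T) : Prop :=
  [/\ a != d, e a d = [|| nilp p, nilp q | nilp r],
      [/\ ipath (a :: p), ipath (a :: q) & ipath (a :: r)],
      [/\ ipath (rcons p d), ipath (rcons q d) & ipath (rcons r d)]
    & [/\ anti p q, anti p r & anti q r]].

Lemma theta_swap12 a d p q r : theta a d p q r -> theta a d q p r.
Proof.
by move=> [ne ead [? ? ?] [? ? ?] [/anti_sym ? ? ?]]; split=> //; rewrite ead orbCA.
Qed.

Lemma theta_swap23 a d p q r : theta a d p q r -> theta a d p r q.
Proof.
by move=> [ne ead [? ? ?] [? ? ?] [? ? /anti_sym ?]]; split=> //; rewrite ead [nilp q || _]orbC.
Qed.

(** An upward closed set of triples; its minimal elements are the arrangements of 0, 1, 2, the arm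
    sizes of the house itself. *)
Definition house_sizes (i j k : nat) : bool :=
  [&& 0 < i + j, 0 < i + k, 0 < j + k & [|| 1 < i, 1 < j | 1 < k]].

End InducedPaths.

(** * Undoing a subdivision: a vertex of an arm is bypassed by an added edge *)

Section AddEdge.
Variables (G : sgraph) (u w : G).
Hypothesis ne_uw : u != w.

Definition add_edge_adj : rel G := fun x y =>
  [|| adj x y, (x == u) && (y == w) | (x == w) && (y == u)].

Lemma add_edge_sym : symmetric add_edge_adj.
Proof.
move=> x y; rewrite /add_edge_adj adj_sym; congr orb; rewrite orbC.
by congr orb; apply: andbC.
Qed.

Lemma add_edge_irrefl : irreflexive add_edge_adj.
Proof.
move=> x; rewrite /add_edge_adj adj_irrefl /=.
by case: (x =P u) => [->|_]; rewrite ?(negbTE ne_uw) ?andbF.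
Qed.

Definition add_edge : sgraph := SGraph add_edge_sym add_edge_irrefl.
End AddEdge.

(** The exact image is recorded because putting a bypassed vertex back requires knowing that it is
    outside the image and which vertices of the image it sees. *)
Definition realizes_house (G : sgraph) (V : pred G) : Prop :=
  exists2 K : sgraph, subdivision house K &
    exists f : K -> G, [/\ injective f, forall x y, adj (f x) (f y) = adj x y & codom f =i V].

Lemma realizes_house_minor (G : sgraph) (V : pred G) :
  realizes_house V -> induced_topological_minor house G.
Proof.
move=> [K sK [f [f_inj f_adj _]]]; exists K => //; exists (f @: K).
have fS x : f x \in f @: K by apply: imset_f.
exists (fun x => exist _ (f x) (fS x)) => //.
apply: inj_card_bij; first by move=> x y /(congr1 val) /f_inj.
by rewrite card_sig card_imset // cardsT.
Qed.

Definition theta_set (T : eqType) (a d : T) (p q r : seq T) : pred T :=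
  mem (a :: d :: p ++ q ++ r).

Lemma theta_set_swap12 (T : eqType) (a d : T) p q r :
  theta_set a d p q r =i theta_set a d q p r.
Proof. by move=> x; rewrite !inE !mem_cat; do !case: (_ \in _); rewrite ?orbT. Qed.

Lemma theta_set_swap23 (T : eqType) (a d : T) p q r :
  theta_set a d p q r =i theta_set a d p r q.
Proof. by move=> x; rewrite !inE !mem_cat; do !case: (_ \in _); rewrite ?orbT. Qed.

Lemma theta_set_cons (T : eqType) (a d x : T) p q r y :
  (y \in theta_set a d (x :: p) q r) = (y == x) || (y \in theta_set a d p q r).
Proof.
rewrite -[y \in theta_set a d p q r]/(y \in a :: d :: p ++ q ++ r).
rewrite -[LHS]/(y \in a :: d :: x :: p ++ q ++ r) !(in_cons, inE) !mem_cat.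
by do !case: (_ == _); rewrite ?orbT.
Qed.

Lemma realizes_house_eq (G : sgraph) (V V' : pred G) :
  V =i V' -> realizes_house V -> realizes_house V'.
Proof.
by move=> eV [K sK [f [? ? fV]]]; exists K => //; exists f; split=> // x; rewrite fV eV.
Qed.

Lemma house_theta (G : sgraph) (a d b c x : G) :
  theta (@adj G) a d [::] [:: x] [:: b; c] ->
  realizes_house (theta_set a d [::] [:: x] [:: b; c]).
Proof.
move=> [ne_ad /= ad [_ /ipath_cons[ax exa _] /ipath_cons[abc eabc /ipath_cons[bc ebc _]]]
  [_ /ipath_cons[xd edx _] /ipath_cons[bcd ebcd /ipath_cons[cd ecd _]]] [_ _ an]].
move: abc bc ax bcd cd xd; rewrite /= !inE !negb_or.
move=> /andP[ab ac] bc ax /andP[_ bd] cd xd.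
have [xb exb] := an x b (mem_head _ _) (mem_head _ _).
have [xc exc] : x != c /\ ~~ adj x c by apply: an; rewrite !inE eqxx ?orbT.
pose s := [:: a; b; c; d; x].
have us : uniq s.
  by rewrite /= !inE !negb_or ab ac ne_ad ax bc bd cd /= !(eq_sym _ x) xb xc xd.
have E : [/\ adj a b, adj a c = false, adj a x & adj b c] /\
    [/\ adj b d = false, adj b x = false, adj c d, adj c x = false & adj d x].
  split; split.
  - by rewrite eabc ?inE ?eqxx.
  - by rewrite eabc ?inE ?eqxx ?orbT //= eq_sym (negbTE bc).
  - by rewrite exa ?inE ?eqxx.
  - by rewrite ebc ?inE ?eqxx.
  - by rewrite ebcd ?inE ?eqxx ?orbT //= eq_sym (negbTE cd).
  - by rewrite adj_sym (negbTE exb).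
  - by rewrite ecd ?inE ?eqxx.
  - by rewrite adj_sym (negbTE exc).
  - by rewrite adj_sym edx ?inE ?eqxx.
exists house; first exact: subdivision_refl.
exists (fun i : 'I_5 => nth a s i); split.
- by move=> i j /eqP; rewrite nth_uniq // => /eqP/val_inj.
- move: E => [[e1 e2 e3 e4] [e5 e6 e7 e8 e9]].
  by case=> [[|[|[|[|[|//]]]]] lt_i] [[|[|[|[|[|//]]]]] lt_j];
    rewrite /= ?adj_irrefl // 1?(e1, e2, e3, e4, e5, e6, e7, e8, e9, ad) //;
    rewrite adj_sym ?(e1, e2, e3, e4, e5, e6, e7, e8, e9, ad).
- have sV : s =i theta_set a d [::] [:: x] [:: b; c].
    by move=> v; rewrite !inE; do !case: (_ == _).
  move=> v; rewrite -sV; apply/codomP/idP => [[i ->]|/(nthP a)[i lt_i <-]].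
    by apply: mem_nth; apply: ltn_ord.
  by exists (Ordinal (lt_i : i < 5)).
Qed.

Lemma eq_in_ipath (T : eqType) (e e' : rel T) s :
  {in s &, e =2 e'} -> ipath e s = ipath e' s.
Proof.
elim: s => //= x s IH ee'; congr [&& _, _ & _].
  by apply: eq_in_all => y ys; rewrite ee' ?inE ?eqxx ?ys ?orbT.
by apply: IH => y z ys zs; apply: ee'; rewrite inE ?ys ?zs orbT.
Qed.

Lemma add_edge_adj_out (G : sgraph) (u w y z : G) :
  (y != u) && (z != u) || (y != w) && (z != w) -> add_edge_adj u w y z = adj y z.
Proof.
rewrite /add_edge_adj => /orP[/andP[/negbTE-> /negbTE->]|/andP[/negbTE-> /negbTE->]];
  by rewrite ?andbF ?orbF.
Qed.

Lemma theta_memE (T : eqType) (e : rel T) a d p q r : symmetric e -> theta e a d p q r ->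
  [/\ a \notin p, d \notin p, forall y, y \in p -> y \notin q
    & {in p & q, forall y z, ~~ e y z}].
Proof.
move=> e_sym [_ _ [/ipath_cons[ap _ _] _ _] [ip _ _] [an _ _]]; split=> //.
- move: ip; rewrite -cats1 => /ipath_cat[_ _ j]; apply/negP=> dp.
  by have [] := j d d dp (mem_head _ _); rewrite eqxx.
- by move=> y yp; apply/negP=> yq; have [] := an y y yp yq; rewrite eqxx.
- by move=> y z yp zq; have [] := an y z yp zq.
Qed.

Section Shorten.
Variables (G : sgraph) (a d x : G) (p q r : seq G).
Hypotheses (th : theta (@adj G) a d (x :: p) q r)
  (sz : house_sizes (size p) (size q) (size r)).
Let w := head d p.

Let w_cases : w = d /\ p = [::] \/ w \in p /\ exists p', p = w :: p'.
Proof.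
rewrite /w; case: (p) => [|y p']; [by left | right].
by split; [apply: mem_head | exists p'].
Qed.

Let mem_facts := (theta_memE (@adj_sym G) th,
  theta_memE (@adj_sym G) (theta_swap12 (@adj_sym G) th),
  theta_memE (@adj_sym G) (theta_swap12 (@adj_sym G) (theta_swap23 (@adj_sym G) th)),
  theta_memE (@adj_sym G) (theta_swap23 (@adj_sym G) th)).

Lemma shorten_neq : a != w.
Proof.
case: mem_facts => -[[[ap _ _ _] _] _] _; case: th => ne_ad _ _ _ _.
case: w_cases => [[-> //]|[wp _]].
by apply: contraNneq ap => ->; rewrite inE wp orbT.
Qed.

(** For empty [p] the vertex [w] is [d], and an edge [ad] would need [q] or [r] empty; the sizes
    after shortening allow no second empty arm. *)
Lemma shorten_nonadj : adj a w = false.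
Proof.
case: th => ne_ad ead [/ipath_cons[_ eax _] _ _] [/ipath_cons[xp _ _] _ _] _.
case: w_cases => [[-> p0]|[wp _]].
  by move: sz; rewrite ead p0 /nilp /house_sizes /=; lia.
rewrite eax ?inE ?wp ?orbT //=; apply: contraNF xp => /eqP <-.
by rewrite mem_rcons inE wp orbT.
Qed.

Lemma shorten_adj y : y \in a :: d :: p ++ q ++ r -> adj y x = (y == a) || (y == w).
Proof.
case: mem_facts => -[[[ap dp pq epq] [aq _ _ _]] [ar _ _ _]] [_ _ pr epr].
case: th => ne_ad ead [/ipath_cons[_ eax _] _ _] [/ipath_cons[xp ex _] _ _] _.
have wne (s : seq G) : (forall z, z \in x :: p -> z \notin s) -> d \notin s -> w \notin s.
  move=> ps ds; case: w_cases => [[-> //]|[wp _]].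
  by apply: ps; rewrite inE wp orbT.
have xd y' : y' \in rcons p d -> adj y' x = (y' == a) || (y' == w).
  move=> yp; rewrite adj_sym ex //.
  have -> : head x (rcons p d) = w by rewrite /w; case: (p).
  rewrite [y' == a](negbTE _) //; apply: contraTneq yp => ->.
  by rewrite mem_rcons inE negb_or ne_ad; move: ap; rewrite inE negb_or => /andP[].
rewrite inE => /orP[/eqP->|]; first by rewrite eax ?eqxx ?mem_head.
rewrite inE => /orP[/eqP->|]; first by apply: xd; rewrite mem_rcons mem_head.
rewrite mem_cat => /orP[yp|]; first by apply: xd; rewrite mem_rcons inE yp orbT.
have out (s : seq G) : (forall z, z \in x :: p -> z \notin s) -> d \notin s -> a \notin s ->
    {in x :: p & s, forall y z, ~~ adj y z} -> y \in s -> adj y x = (y == a) || (y == w).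
  move=> ps ds as_ es ys; rewrite adj_sym (negbTE (es x y _ ys)) ?mem_head //.
  apply/esym/negbTE; rewrite negb_or; apply/andP; split; apply: contraTneq ys => -> //.
  exact: wne.
case: mem_facts => -[[_ [_ dq _ _]] [_ dr _ _]] _.
by rewrite mem_cat => /orP[]; apply: out.
Qed.

(** The vertex [x] stays in the graph but leaves the theta. The other arms avoid [w], so the new
    edge does not disturb them; if [w = d], it is the edge [ad] that the empty arm demands. *)
Lemma theta_shorten (ne_aw : a != w) : theta (@adj (add_edge ne_aw)) a d p q r.
Proof.
case: mem_facts => -[[[ap dp pq epq] [aq dq _ _]] [ar dr _ _]] [_ _ pr epr].
case: th => ne_ad ead [/ipath_cons[_ eax /ipath_cons[xp _ ip]] iq ir] [ipd iqd ird] [apq apr aqr].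
have wne (s : seq G) : (forall z, z \in x :: p -> z \notin s) -> d \notin s -> w \notin s.
  move=> ps ds; case: w_cases => [[-> //]|[wp _]].
  by apply: ps; rewrite inE wp orbT.
have noa (s t : seq G) : a \notin s -> a \notin t -> {in s & t, @adj (add_edge ne_aw) =2 @adj G}.
  move=> as_ at_ y z ys zt; apply: add_edge_adj_out.
  by rewrite (memPn as_) ?(memPn at_).
have anti_noa (s t : seq G) : a \notin s -> a \notin t -> anti (@adj G) s t -> anti (@adj (add_edge ne_aw)) s t.
  by move=> as_ at_ ast y z ys zt; rewrite (noa s t as_ at_) //; apply: ast.
have ad (s : seq G) : a \notin s -> a \notin rcons s d by rewrite mem_rcons inE negb_or ne_ad.
have rcons_noa s : a \notin s -> ipath (@adj G) (rcons s d) ->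
    ipath (@adj (add_edge ne_aw)) (rcons s d).
  move=> /ad as_ i; rewrite (@eq_in_ipath _ _ (@adj G)) //; exact: noa.
have cons_now s : w \notin s -> ipath (@adj G) (a :: s) -> ipath (@adj (add_edge ne_aw)) (a :: s).
  move=> ws i; rewrite (@eq_in_ipath _ _ (@adj G)) // => y z yas zas.
  have was: w \notin a :: s by rewrite inE negb_or eq_sym ne_aw.
  by apply: add_edge_adj_out; rewrite (memPn was) ?(memPn was) ?orbT.
have ap' : a \notin p by move: ap; rewrite inE negb_or => /andP[].
split=> //.
- rewrite /= /add_edge_adj ead eqxx (negbTE ne_aw) orbF /= orbC; congr (_ || _).
  rewrite eq_sym; case: w_cases => [[-> ->]|[wp [p' ->]]]; first by rewrite eqxx.
  by apply: contraNF dp => /eqP <-; rewrite inE wp orbT.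
- split; [|by apply: cons_now => //; apply: wne|by apply: cons_now => //; apply: wne].
  apply/ipath_cons; split=> //; last first.
    by rewrite (@eq_in_ipath _ _ (@adj G)) //; apply: noa.
  move=> y yp; rewrite /= /add_edge_adj eqxx (negbTE ne_aw) orbF eax ?inE ?yp ?orbT //=.
  have -> : (y == x) = false by apply: contraNF xp => /eqP <-.
  by rewrite /w; case: (p) yp.
- split; [|exact: rcons_noa|exact: rcons_noa].
  by apply: rcons_noa => //; case/ipath_cons: ipd.
- split; apply: anti_noa => //.
    by move=> y z yp zq; apply: apq => //; rewrite inE yp orbT.
  by move=> y z yp zr; apply: apr => //; rewrite inE yp orbT.
Qed.

(** The edge of [K] that is mapped to [aw] is subdivided and its new vertex is sent to [x].
    Subdividing deletes exactly the edge that had been added to [G]. *)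
Lemma realizes_house_lengthen (ne_aw : a != w) :
  realizes_house (theta_set a d p q r : pred (add_edge ne_aw)) ->
  realizes_house (theta_set a d (x :: p) q r).
Proof.
case: mem_facts => -[[[_ _ pq _] _] [rp _ _ _]] [_ _ pr _].
have [_ _ [/ipath_cons[ax _ /ipath_cons[xp _ _]] _ _] [/ipath_cons[xpd _ _] _ _] _] := th.
have wV : w \in a :: d :: p ++ q ++ r.
  case: w_cases => [[-> _]|[wp _]]; first by rewrite !inE eqxx orbT.
  by rewrite !inE !mem_cat wp !orbT.
move=> [K sK [f [f_inj f_adj fV]]].
have [|u fu] := codomP (_ : a \in codom f); first by rewrite fV inE eqxx.
have [|v fv] := codomP (_ : w \in codom f).
  by rewrite fV; apply: wV.
have xV : x \notin codom f.
  rewrite fV !inE !negb_or !mem_cat !negb_or xp.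
  rewrite pq ?pr ?mem_head //= andbT; apply/andP; split.
    by apply: contraNneq ax => ->; rewrite mem_head.
  by apply: contraNneq xpd => ->; rewrite mem_rcons mem_head.
have nfx y : (f y == x) = false by apply: contraNF xV => /eqP <-; apply: codom_f.
exists (subdivide_edge u v).
  apply: subdivision_step => //; rewrite -f_adj -fu -fv /= /add_edge_adj !eqxx orbT //.
exists (fun o => if o is Some y then f y else x); split.
- move=> [y|] [z|] //=; first by move/f_inj->.
    by move/eqP; rewrite nfx.
  by move/esym/eqP; rewrite nfx.
- have adj_x y : @adj G (f y) x = (y == u) || (y == v).
    rewrite shorten_adj; last by have := codom_f f y; rewrite fV.
    by rewrite {1}fu fv !(inj_eq f_inj).
  move=> [y|] [z|] /=; last by rewrite adj_irrefl.
  + rewrite -f_adj /= /add_edge_adj !xpair_eqE -!(inj_eq f_inj) -fu -fv.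
    case: (boolP ((f y == a) && _)) => [/andP[/eqP-> /eqP->]|_].
      by rewrite shorten_nonadj andbF.
    case: (boolP ((f y == w) && _)) => [/andP[/eqP-> /eqP->]|_].
      by rewrite adj_sym shorten_nonadj andbF.
    by rewrite !orbF !andbT.
  + exact: adj_x.
  + by rewrite adj_sym adj_x.
- have consV y : (y \in theta_set a d (x :: p) q r) = (y == x) || (y \in codom f).
    by rewrite fV; apply: theta_set_cons.
  move=> y; rewrite consV; apply/codomP/orP => [[[z|] ->]|[/eqP->|/codomP[z ->]]].
  + by right; apply: codom_f.
  + by left.
  + by exists None.
  + by exists (Some z).
Qed.
End Shorten.

(** Induction on the total size of the arms, for all graphs at once, since shortening an arm changes
    the graph. Arms are shortened as long as the sizes stay admissible. *)
Theorem theta_minor (G : sgraph) (a d : G) (p q r : seq G) :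
  theta (@adj G) a d p q r -> house_sizes (size p) (size q) (size r) ->
  induced_topological_minor house G.
Proof.
suff: theta (@adj G) a d p q r -> house_sizes (size p) (size q) (size r) ->
    realizes_house (theta_set a d p q r).
  by move=> h /h{h}h /h; apply: realizes_house_minor.
move En: (size p + size q + size r) => n.
elim: n G p q r a d En => [|n IH] G p q r a d En th; first by rewrite /house_sizes; lia.
have shorten x (p' q' r' : seq G) : size p' + size q' + size r' = n ->
    theta (@adj G) a d (x :: p') q' r' -> house_sizes (size p') (size q') (size r') ->
    realizes_house (theta_set a d (x :: p') q' r').
  move=> En' th' sz; apply: (realizes_house_lengthen th' sz (ne_aw := shorten_neq th')).
  by apply: IH => //; apply: (theta_shorten th').
have sym := @adj_sym G.
have swap12 := @realizes_house_eq G _ _ (theta_set_swap12 a d _ _ _).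
have swap23 := @realizes_house_eq G _ _ (theta_set_swap23 a d _ _ _).
move=> sz.
have [/andP[p0 szp]|np] := boolP ((0 < size p) && house_sizes (size p).-1 (size q) (size r)).
  by case: p En th p0 szp {sz} => //= x p [En] th _ szp; apply: shorten => //; lia.
have [/andP[q0 szq]|nq] := boolP ((0 < size q) && house_sizes (size q).-1 (size p) (size r)).
  case: q En th q0 szq {np sz} => //= x q En /(theta_swap12 sym) th _ szq.
  by apply: swap12; apply: (@shorten x q p r) => //; lia.
have [/andP[r0 szr]|nr] := boolP ((0 < size r) && house_sizes (size r).-1 (size p) (size q)).
  case: r En th r0 szr {np nq sz} => //= x r En /(theta_swap23 sym)/(theta_swap12 sym) th _ szr.
  by apply: swap23; apply: swap12; apply: (@shorten x r p q) => //; lia.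
have base (p' q' r' : seq G) : theta (@adj G) a d p' q' r' ->
    (size p', size q', size r') = (0, 1, 2) -> realizes_house (theta_set a d p' q' r').
  by case: p' q' r' => [|//] [|x [|//]] // [|b [|c [|//]]] // /house_theta.
(* An arm of three or more vertices can always be shortened, so only sizes up to 2 need
   inspection. *)
have : [|| (size p, size q, size r) == (0, 1, 2), (size p, size r, size q) == (0, 1, 2),
    (size q, size p, size r) == (0, 1, 2), (size q, size r, size p) == (0, 1, 2),
    (size r, size p, size q) == (0, 1, 2) | (size r, size q, size p) == (0, 1, 2)].
  move: (size p) (size q) (size r) sz np nq nr => i j k.
  by case: i => [|[|[|i]]]; case: j => [|[|[|j]]]; case: k => [|[|[|k]]].
have th12 := theta_swap12 sym th; have th23 := theta_swap23 sym th.
case/or4P => [/eqP/base|/eqP/base|/eqP/base|/or3P[] /eqP/base]; first exact.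
- by move=> h; apply/swap23/h.
- by move=> h; apply/swap12/h.
- by move=> h; apply/swap12/swap23/h; apply: theta_swap23.
- by move=> h; apply/swap23/swap12/h; apply: theta_swap12.
- by move=> h; apply/swap12/swap23/swap12/h; apply/theta_swap12/theta_swap23.
Qed.

(** * Subdivisions of the house are thetas *)

Fixpoint arcs (T : Type) (x : T) (s : seq T) : seq (T * T) :=
  if s is y :: s' then (x, y) :: arcs y s' else [::].

Lemma arcs_cat (T : Type) (x : T) s t : arcs x (s ++ t) = arcs x s ++ arcs (last x s) t.
Proof. by elim: s x => //= y s IH x; rewrite IH. Qed.

Lemma arcs_map (T S : Type) (g : T -> S) x s :
  arcs (g x) (map g s) = [seq (g u.1, g u.2) | u <- arcs x s].
Proof. by elim: s x => //= y s IH x; rewrite IH. Qed.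

Lemma mem_arcs (T : eqType) (x u v : T) s :
  (u, v) \in arcs x s -> (u \in belast x s) && (v \in s).
Proof.
elim: s x => //= y s IH x; rewrite !inE xpair_eqE => /orP[/andP[-> ->] //|/IH/andP[-> ->]].
by rewrite !orbT.
Qed.

Lemma arcs_split (T : eqType) (x u v : T) s :
  (u, v) \in arcs x s -> exists s1 s2, s = s1 ++ v :: s2 /\ last x s1 = u.
Proof.
elim: s x => //= y s IH x; rewrite inE => /orP[/eqP[-> ->]|/IH[s1 [s2 [-> <-]]]].
  by exists [::], s.
by exists (y :: s1), s2.
Qed.

Lemma ipath_arcs (T : eqType) (e : rel T) x s :
  uniq (x :: s) ->
  {in x :: s &, forall y z, e y z = ((y, z) \in arcs x s) || ((z, y) \in arcs x s)} ->
  ipath e (x :: s).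
Proof.
elim: s x => [|y s IH] x; first by [].
rewrite [uniq _]/= => /andP[xs ys] es; apply/ipath_cons; split=> //.
  move=> z zs; rewrite es; [|exact: mem_head|by rewrite inE zs orbT].
  have nxs u v w : (u, v) \in arcs y w -> {subset w <= s} -> u != x /\ v != x.
    move=> /mem_arcs /andP[/mem_belast uw vw] ws; split; apply: contraNneq xs => <-.
      by move: uw; rewrite !inE => /orP[->//|/ws ->]; rewrite orbT.
    by rewrite inE ws ?orbT.
  have z_x : (z == x) = false by apply: contraNF xs => /eqP <-.
  rewrite /= !inE !xpair_eqE eqxx z_x /=.
  rewrite [X in _ || X || _](_ : _ = false); last by apply/negP => /nxs[] // /eqP.
  by rewrite [X in _ || X](_ : _ = false) ?orbF //; apply/negP => /nxs[] // _ /eqP.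
apply: IH => // u v us vs; rewrite es; [|by rewrite inE us orbT|by rewrite inE vs orbT].
by rewrite /= !inE !xpair_eqE (negbTE (memPn xs _ us)) (negbTE (memPn xs _ vs)).
Qed.

Definition theta_arcs (T : eqType) (a d : T) (p q r : seq T) : seq (T * T) :=
  arcs a (rcons p d) ++ arcs a (rcons q d) ++ arcs a (rcons r d).

(** Each edge is listed once and in one direction, so that dropping its arc drops the edge. *)
Definition simple_arcs (T : eqType) (E : seq (T * T)) : Prop :=
  uniq E /\ forall x y, (x, y) \in E -> (y, x) \notin E.

Lemma simple_arcs_perm (T : eqType) (E F : seq (T * T)) :
  perm_eq E F -> simple_arcs E -> simple_arcs F.
Proof.
move=> eF [uE oE]; split; first by rewrite -(perm_uniq eF).
by move=> x y; rewrite -!(perm_mem eF); apply: oE.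
Qed.

(** A second description, for a theta that is the whole graph, by a list of its edges. Subdividing
    replaces one arc by two, which is easier to follow here than through the adjacency conditions of
    [theta]. *)
Definition drawn_theta (T : eqType) (e : rel T) (a d : T) (p q r : seq T) : Prop :=
  let V := a :: d :: p ++ q ++ r in
  let E := theta_arcs a d p q r in
  [/\ uniq V, (forall x, x \in V), simple_arcs E
    & forall x y, e x y = ((x, y) \in E) || ((y, x) \in E)].

Lemma drawn_theta_perm (T : eqType) (e : rel T) (a d : T) (p q r p' q' r' : seq T) :
  perm_eq (p ++ q ++ r) (p' ++ q' ++ r') ->
  perm_eq (theta_arcs a d p q r) (theta_arcs a d p' q' r') ->
  drawn_theta e a d p q r -> drawn_theta e a d p' q' r'.
Proof.
move=> pV pE [uV V simE eE].
have pV' : perm_eq (a :: d :: p ++ q ++ r) (a :: d :: p' ++ q' ++ r') by rewrite !perm_cons.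
split; first by rewrite -(perm_uniq pV').
- by move=> x; rewrite -(perm_mem pV').
- exact: simple_arcs_perm pE simE.
- by move=> x y; rewrite eE !(perm_mem pE).
Qed.

Lemma drawn_theta_swap12 (T : eqType) (e : rel T) (a d : T) (p q r : seq T) :
  drawn_theta e a d p q r -> drawn_theta e a d q p r.
Proof. by apply: drawn_theta_perm; rewrite /theta_arcs perm_catCA. Qed.

Lemma drawn_theta_swap23 (T : eqType) (e : rel T) (a d : T) (p q r : seq T) :
  drawn_theta e a d p q r -> drawn_theta e a d p r q.
Proof. by apply: drawn_theta_perm; rewrite /theta_arcs perm_cat2l perm_catC. Qed.

Section DrawnToTheta.
Variables (T : eqType) (e : rel T) (a d : T) (p q r : seq T).
Hypothesis dt : drawn_theta e a d p q r.

(** The interiors of the arms are disjoint, so an edge with an end in [p] is an arc of that arm. The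
    other arms follow by permuting. *)
Lemma drawn_path : [/\ ipath e (a :: p), ipath e (rcons p d) & anti e p q].
Proof.
have [uV _ simE eE] := dt.
move: uV; rewrite /= inE !mem_cat !negb_or !cat_uniq has_cat !negb_or.
move=> /and3P[/and4P[ne_ad ap aq ar] /and3P[dp dq dr] /and3P[up /andP[/hasPn pq /hasPn pr] _]].
have uapd : uniq (a :: rcons p d) by rewrite /= rcons_uniq mem_rcons inE negb_or ne_ad ap dp.
have uap : uniq (a :: p) by rewrite /= ap.
have out_q y z : y \in p -> (y, z) \notin arcs a (rcons q d) /\ (z, y) \notin arcs a (rcons q d).
  move=> yp; have yq : y \notin q by apply: contraL yp => /pq.
  have yd : y != d by apply: contraNneq dp => <-.
  have ya : y != a by apply: contraNneq ap => <-.
  split; apply/negP => /mem_arcs /andP[]; rewrite belast_rcons mem_rcons !inE.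
    by rewrite (negbTE ya) (negbTE yq).
  by rewrite (negbTE yd) (negbTE yq).
have out_r y z : y \in p -> (y, z) \notin arcs a (rcons r d) /\ (z, y) \notin arcs a (rcons r d).
  move=> yp; have yq : y \notin r by apply: contraL yp => /pr.
  have yd : y != d by apply: contraNneq dp => <-.
  have ya : y != a by apply: contraNneq ap => <-.
  split; apply/negP => /mem_arcs /andP[]; rewrite belast_rcons mem_rcons !inE.
    by rewrite (negbTE ya) (negbTE yq).
  by rewrite (negbTE yd) (negbTE yq).
have eEp y z : (y \in p) || (z \in p) ->
    e y z = ((y, z) \in arcs a (rcons p d)) || ((z, y) \in arcs a (rcons p d)).
  move=> yz; rewrite eE !mem_cat.
  have [[q1 q2] [r1 r2]] : ((y, z) \notin arcs a (rcons q d) /\ (z, y) \notin arcs a (rcons q d)) /\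
     ((y, z) \notin arcs a (rcons r d) /\ (z, y) \notin arcs a (rcons r d)).
    by case/orP: yz => [yp|zp]; split; [apply: out_q | apply: out_r | case: (out_q z y zp) | case: (out_r z y zp)].
  by rewrite (negbTE q1) (negbTE q2) (negbTE r1) (negbTE r2) !orbF.
have last_arc s y z : y != d -> z != d ->
    ((y, z) \in arcs a (rcons s d)) = ((y, z) \in arcs a s).
  move=> yd zd; rewrite -cats1 arcs_cat mem_cat /= inE xpair_eqE.
  by rewrite [z == d](negbTE zd) andbF orbF.
have irr y : e y y = false.
  rewrite eE orbb; apply/negbTE/negP => yE.
  by have := simE.2 _ _ yE; rewrite yE.
split.
- apply: ipath_arcs => // y z yap zap.
  have nd x : x \in a :: p -> x != d.
    by rewrite inE => /orP[/eqP->//|xp]; apply: contraNneq dp => <-.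
  rewrite -!(last_arc p) ?nd //.
  move: yap zap; rewrite !inE => /orP[/eqP->|yp] /orP[/eqP->|zp]; try by rewrite eEp ?zp ?yp ?orbT.
  rewrite irr orbb; apply/esym/negbTE/negP => /mem_arcs /andP[_].
  by rewrite mem_rcons inE (negbTE ne_ad) (negbTE ap).
- have -> : rcons p d = head d p :: behead (rcons p d) by case: (p).
  apply: ipath_arcs.
    by move: uapd; case: (p) => //= y p' /andP[].
  have -> : head d p :: behead (rcons p d) = rcons p d by case: (p).
  have -> : arcs (head d p) (behead (rcons p d)) = behead (arcs a (rcons p d)) by case: (p).
  have in_behead y z : y != a -> ((y, z) \in behead (arcs a (rcons p d))) = ((y, z) \in arcs a (rcons p d)).
    by move=> ya; case: (p) => [|w p'] /=; rewrite !inE ?xpair_eqE (negbTE ya).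
  have na x : x \in rcons p d -> x != a.
    by apply: contraTneq => ->; rewrite mem_rcons inE (negbTE ne_ad).
  move=> y z yp zp; rewrite !in_behead ?na //.
  move: yp zp; rewrite !mem_rcons !inE => /orP[/eqP->|yp] /orP[/eqP->|zp]; try by rewrite eEp ?zp ?yp ?orbT.
  rewrite irr orbb; apply/esym/negbTE/negP => /mem_arcs /andP[].
  by rewrite belast_rcons inE eq_sym (negbTE ne_ad) (negbTE dp).
- move=> y z yp zq; split.
    by apply: contraTneq zq => <-; apply: contraL yp => /pq.
  have zp : z \notin p by apply: pq.
  have zd : z != d by apply: contraNneq dq => <-.
  have za : z != a by apply: contraNneq aq => <-.
  rewrite eEp ?yp // negb_or; apply/andP; split; apply/negP => /mem_arcs /andP[];
    rewrite belast_rcons mem_rcons !inE; last by rewrite (negbTE za) (negbTE zp).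
  by rewrite (negbTE zd) (negbTE zp).
Qed.
End DrawnToTheta.

Lemma theta_of_drawn (T : eqType) (e : rel T) (a d : T) (p q r : seq T) :
  drawn_theta e a d p q r -> theta e a d p q r.
Proof.
move=> dt; have dt12 := drawn_theta_swap12 dt; have dt23 := drawn_theta_swap23 dt.
have [ip1 ip2 apq] := drawn_path dt.
have [_ _ apr] := drawn_path dt23.
have [iq1 iq2 aqr] := drawn_path (drawn_theta_swap23 dt12).
have [ir1 ir2 _] := drawn_path (drawn_theta_swap12 dt23).
have [uV _ _ eE] := dt; split=> //; first by case/andP: uV; rewrite inE negb_or => /andP[].
have direct s : uniq (a :: d :: s) ->
    ((a, d) \in arcs a (rcons s d)) = nilp s /\ (d, a) \notin arcs a (rcons s d).
  rewrite /= inE negb_or => /andP[/andP[ne_ad as_] /andP[ds _]]; split.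
    case: s as_ ds => [|y s] as_ ds /=; first by rewrite inE eqxx.
    move: as_ ds; rewrite !inE !negb_or xpair_eqE => /andP[ay as_] /andP[dy ds].
    rewrite (negbTE dy) andbF /=; apply/negbTE/negP => /mem_arcs/andP[].
    by rewrite belast_rcons inE (negbTE ay) (negbTE as_).
  by apply/negP => /mem_arcs/andP[_]; rewrite mem_rcons inE (negbTE ne_ad) (negbTE as_).
have sub s : s \in [:: p; q; r] -> uniq (a :: d :: s).
  move=> sV; apply: subseq_uniq uV; rewrite /= !eqxx.
  move: sV; rewrite !inE => /or3P[] /eqP->; first exact: prefix_subseq.
    by apply: subseq_trans (prefix_subseq _ _) (suffix_subseq _ _).
  by apply: subseq_trans (suffix_subseq _ _) (suffix_subseq _ _).
have [p1 /negbTE p2] := direct _ (sub p (mem_head _ _)).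
have [|q1 /negbTE q2] := direct q (sub q _); first by rewrite !inE eqxx orbT.
have [|r1 /negbTE r2] := direct r (sub r _); first by rewrite !inE eqxx !orbT.
by rewrite eE !mem_cat p1 q1 r1 p2 q2 r2 !orbF.
Qed.

(** Up to permutation the arcs are [(u, v) :: F], and after subdivision the two arcs through [None]
    together with the lifted [F]. As neither [(u, v)] nor its reverse is in [F], the rest of the
    graph is unchanged. *)
Lemma drawn_theta_subdivide (T : eqType) (e : rel T) (e' : rel (option T)) (a d u v : T)
    (p q r : seq T) :
  drawn_theta e a d p q r -> (u, v) \in arcs a (rcons p d) ->
  (forall x y, e' (Some x) (Some y) = [&& e x y, (x, y) != (u, v) & (x, y) != (v, u)]) ->
  (forall x, e' (Some x) None = (x == u) || (x == v)) ->
  (forall x, e' None (Some x) = (x == u) || (x == v)) -> e' None None = false ->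
  exists2 p', drawn_theta e' (Some a) (Some d) p' (map Some q) (map Some r)
    & size p' = (size p).+1.
Proof.
move=> [uV V simE eE] /arcs_split[s1 [s2 [eq_p last_s1]]] eSS eSN eNS eNN.
(* Since [v] may be [d], the new arm is described together with its end [d]. *)
have [p' eq_p'] : exists p', rcons p' (Some d) = map Some s1 ++ None :: map Some (v :: s2).
  have last_d : last (Some d) (map Some s1 ++ None :: map Some (v :: s2)) = Some d.
    by rewrite last_cat /= last_map -(last_rcons d p d) eq_p last_cat.
  case/lastP E: (map Some s1 ++ _) => [|p' z]; first by case: (s1) E.
  by exists p'; rewrite E last_rcons in last_d; rewrite last_d.
pose F := arcs a s1 ++ arcs v s2 ++ arcs a (rcons q d) ++ arcs a (rcons r d).
have arcs_p : arcs a (rcons p d) = arcs a s1 ++ (u, v) :: arcs v s2.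
  by rewrite eq_p arcs_cat last_s1.
have permE : perm_eq (theta_arcs a d p q r) ((u, v) :: F).
  rewrite /theta_arcs arcs_p /F -catA perm_sym -cat_cons; apply/permP => c.
  by rewrite /= ?count_cat /= ?count_cat; lia.
pose lift (w : T * T) := (Some w.1, Some w.2).
have permE' : perm_eq (theta_arcs (Some a) (Some d) p' (map Some q) (map Some r))
    ((Some u, None) :: (None, Some v) :: map lift F).
  rewrite /theta_arcs eq_p' -!map_rcons !arcs_map arcs_cat /= arcs_map.
  rewrite last_map last_s1 arcs_map /F !map_cat; apply/permP => c.
  by rewrite /lift /= ?count_cat /= ?count_cat; lia.
have permp : perm_eq p' (None :: map Some p).
  have : perm_eq (rcons p' (Some d)) (None :: map Some (rcons p d)).
    rewrite eq_p' eq_p map_cat; apply/permP => c.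
    by rewrite /= ?count_cat /=; lia.
  rewrite map_rcons -rcons_cons => /permP pd; apply/permP => c.
  by have := pd c; rewrite -!cats1 !count_cat => /eqP; rewrite eqn_add2r => /eqP.
have [uE oE] := simple_arcs_perm permE simE.
have permV : perm_eq (Some a :: Some d :: p' ++ map Some q ++ map Some r)
    (None :: map Some (a :: d :: p ++ q ++ r)).
  apply/permP => c; rewrite /= !map_cat !count_cat (permP permp) /=; lia.
exists p'; last by rewrite (perm_size permp) /= size_map.
have lift_inj : injective lift by move=> [? ?] [? ?] [-> ->].
have mem_lift x y : ((Some x, Some y) \in map lift F) = ((x, y) \in F).
  by rewrite -[(Some x, _)]/(lift (x, y)) mem_map.
have lift_None (o o' : option T) : (o, None) \notin map lift F /\ (None, o') \notin map lift F.
  by split; apply/negP => /mapP[].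
have ne_vu : (v == u) = false.
  by apply: contraNF (oE u v (mem_head _ _)) => /eqP->; rewrite mem_head.
split.
- rewrite (perm_uniq permV) cons_uniq map_inj_uniq ?uV ?andbT; last by move=> ? ? [].
  by apply/mapP => -[].
- by move=> x; rewrite (perm_mem permV) inE; case: x => // x; rewrite mem_map ?V // => ? ? [].
- have : simple_arcs ((Some u, None) :: (None, Some v) :: map lift F).
    split.
      rewrite !cons_uniq !inE (map_inj_uniq lift_inj) !negb_or /=.
      have [-> ->] := lift_None (Some u) (Some v).
      by case/andP: uE.
    move=> [x|] [y|]; rewrite !inE !xpair_eqE /= ?andbT ?andbF ?orbF //=.
    + rewrite !mem_lift => xyF; have := oE x y; rewrite inE xyF orbT => /(_ isT).
      by rewrite inE negb_or => /andP[].
    + have [/negbTE-> /negbTE->] := lift_None (Some x) (Some x).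
      by rewrite !orbF => /eqP ->; rewrite -[Some u == _]/(u == v) eq_sym ne_vu.
    + have [/negbTE-> /negbTE->] := lift_None (Some y) (Some y).
      by rewrite !orbF => /eqP ->; rewrite -[Some v == _]/(v == u) ne_vu.
    + by have [/negbTE-> _] := lift_None None None.
  by apply: simple_arcs_perm; rewrite perm_sym.
- move=> [x|] [y|]; rewrite !(perm_mem permE') !inE !xpair_eqE /= ?andbT ?andbF ?orbF //=.
  + rewrite !mem_lift eSS eE !(perm_mem permE) !inE !xpair_eqE.
    have /andP[uvF _] := uE; have vuF := oE u v (mem_head _ _).
    rewrite inE negb_or in vuF; case/andP: vuF => _ vuF; rewrite [(y == u) && _]andbC.
    case: (boolP ((x == u) && _)) => [/andP[/eqP-> /eqP->]|_].
      by rewrite (negbTE uvF) (negbTE vuF) andbF.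
    case: (boolP ((x == v) && _)) => [/andP[/eqP-> /eqP->]|_].
      by rewrite (negbTE uvF) (negbTE vuF) andbF.
    by rewrite /= andbT.
  + have [/negbTE-> /negbTE->] := lift_None (Some x) (Some x).
    by rewrite !orbF eSN.
  + have [/negbTE-> /negbTE->] := lift_None (Some y) (Some y).
    by rewrite !orbF eNS orbC.
  + by have [/negbTE-> _] := lift_None None None.
Qed.

Lemma subdivision_drawn (K : sgraph) : subdivision house K ->
  exists (a d : K) (p q r : seq K), drawn_theta (@adj K) a d p q r /\
    house_sizes (size p) (size q) (size r).
Proof.
elim=> {K} [|K u v _ [a [d [p [q [r [dt sz]]]]]] uv].
  (* In the house, [a] and [d] are joined by an edge, through [e], and through [b] and [c]. *)
  pose o i (lt_i : i < 5) : 'I_5 := Ordinal lt_i.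
  exists (@o 0 isT), (@o 3 isT), [::], [:: @o 4 isT], [:: @o 1 isT; @o 2 isT]; split=> //.
  split=> //; first by case=> [[|[|[|[|[|//]]]]] lt_i].
    by split=> // -[[|[|[|[|[|//]]]]] lt_i] [[|[|[|[|[|//]]]]] lt_j].
  by move=> [[|[|[|[|[|//]]]]] lt_i] [[|[|[|[|[|//]]]]] lt_j].
(* The arm may run through the edge in either direction; [subdivide_edge] treats its two ends
   alike. *)
have step a' d' p' q' r' x y : drawn_theta (@adj K) a' d' p' q' r' ->
    house_sizes (size p') (size q') (size r') ->
    (x, y) \in arcs a' (rcons p' d') -> (x, y) = (u, v) \/ (x, y) = (v, u) ->
    exists (a d : subdivide_edge u v) p q r,
      drawn_theta (@adj (subdivide_edge u v)) a d p q r /\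
      house_sizes (size p) (size q) (size r).
  move=> dt' sz' xy_p xy.
  have [|x'|x'||p'' dt'' sz''] := @drawn_theta_subdivide _ _ (@adj (subdivide_edge u v)) _ _ _ _ _ _ _ dt' xy_p.
  - by move=> x' y' /=; case: xy => -[-> ->] //; rewrite [X in _ && X]andbC.
  - by case: xy => -[-> ->] //; rewrite orbC.
  - by case: xy => -[-> ->] //; rewrite orbC.
  - by [].
  exists (Some a'), (Some d'), p'', (map Some q'), (map Some r'); split=> //.
  by move: sz'; rewrite sz'' !size_map /house_sizes; lia.
have [xy [xyE xy_uv]] : exists xy, xy \in theta_arcs a d p q r /\ (xy = (u, v) \/ xy = (v, u)).
  by case: dt => _ _ _ eE; move: uv; rewrite eE => /orP[uvE|vuE];
    [exists (u, v) | exists (v, u)]; split=> //; [left|right].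
have szC i j k : house_sizes i j k -> house_sizes j i k /\ house_sizes k i j.
  by rewrite /house_sizes; lia.
have [sz2 sz3] := szC _ _ _ sz.
case: xy xyE xy_uv => x y; rewrite !mem_cat => /or3P[] xyE xy_uv.
- exact: step dt sz xyE xy_uv.
- exact: step (drawn_theta_swap12 dt) sz2 xyE xy_uv.
- exact: step (drawn_theta_swap12 (drawn_theta_swap23 dt)) sz3 xyE xy_uv.
Qed.

(** * Thetas from a path attached to a hole *)

Lemma has_split_first (T : Type) (P : pred T) s :
  has P s -> exists s1 x s2, [/\ s = s1 ++ x :: s2, P x & ~~ has P s1].
Proof.
elim: s => //= x s IH; have [Px _|nPx /IH[s1 [y [s2 [-> Py ns1]]]]] := boolP (P x).
  by exists [::], x, s.
by exists (x :: s1), y, s2; split; rewrite //= negb_or nPx.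
Qed.

Section FindTheta.
Variables (T : eqType) (e : rel T).
Hypothesis e_sym : symmetric e.

Definition has_theta : Prop :=
  exists a d p q r, theta e a d p q r /\ house_sizes (size p) (size q) (size r).

Lemma ipath_uniq s : ipath e s -> uniq s.
Proof. by elim: s => //= x s IH /and3P[-> _ /IH]. Qed.

Lemma ipath_catl s t : ipath e (s ++ t) -> ipath e s.
Proof. by case/ipath_cat. Qed.

Lemma ipath_catr s t : ipath e (s ++ t) -> ipath e t.
Proof. by case/ipath_cat. Qed.

Lemma ipath_mid s x t : ipath e (s ++ x :: t) ->
  [/\ ipath e (rcons s x), ipath e (x :: t) & anti e s t].
Proof.
move=> i; have := i; rewrite -cat_rcons => /ipath_cat[i1 _ j].
have u := ipath_uniq i1; split=> //; first exact: ipath_catr i.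
move=> y z ys zt; have [|ne ->] := j y z _ zt; first by rewrite mem_rcons inE ys orbT.
split=> //; rewrite last_rcons; move: u; rewrite rcons_uniq => /andP[xs _].
by rewrite (negbTE (memPn xs _ ys)).
Qed.

Lemma ipath_rcons s x :
  reflect [/\ x \notin s, {in s, forall y, e y x = (y == last x s)} & ipath e s]
    (ipath e (rcons s x)).
Proof.
have -> : ipath e (rcons s x) = ipath e (x :: rev s) by rewrite -ipath_rev // rev_rcons.
have hd : head x (rev s) = last x s by case/lastP: s => // s y; rewrite rev_rcons last_rcons.
apply: (iffP (ipath_cons _ _ _)); rewrite mem_rev ipath_rev // => -[xs es i]; split=> // y ys.
  by rewrite e_sym es ?mem_rev // hd.
by rewrite e_sym es -?(mem_rev s) // hd.
Qed.

Lemma anti_catl s1 s2 t : anti e s1 t -> anti e s2 t -> anti e (s1 ++ s2) t.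
Proof. by move=> a1 a2 x y; rewrite mem_cat => /orP[]; [apply: a1 | apply: a2]. Qed.

Lemma anti_eq_mem s s' t t' : s =i s' -> t =i t' -> anti e s t -> anti e s' t'.
Proof. by move=> es et a x y; rewrite -es -et; apply: a. Qed.

(* [a :: R] is an induced cycle. *)
Definition closes (a : T) (R : seq T) : Prop :=
  [/\ ipath e R, a \notin R & {in R, forall y, e a y = (y == head a R) || (y == last a R)}].

Lemma head_rev (a : T) s : head a (rev s) = last a s.
Proof. by case/lastP: s => // s x; rewrite rev_rcons last_rcons. Qed.

Lemma last_rev (a : T) s : last a (rev s) = head a s.
Proof. by case: s => // x s; rewrite rev_cons last_rcons. Qed.

Lemma closes_rev a R : closes a R -> closes a (rev R).
Proof.
move=> [iR aR eR]; split; rewrite ?ipath_rev ?mem_rev // => y; rewrite mem_rev => yR.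
by rewrite eR // head_rev last_rev orbC.
Qed.

Lemma closes_prefix a A x C : closes a (A ++ x :: C) -> ipath e (a :: A).
Proof.
move=> [iR aR eR]; apply/ipath_cons; split; last exact: ipath_catl iR.
  by apply: contra aR; rewrite mem_cat => ->.
move=> y yA; rewrite eR ?mem_cat ?yA // last_cat /=.
rewrite [y == last _ _](negbTE _) ?orbF; first by case: (A) yA.
move/ipath_uniq: iR; rewrite cat_uniq => /and3P[_ /hasPn AC _].
by apply: contraTneq yA => ->; apply: AC; apply: mem_last.
Qed.

Lemma closes_suffix a A x C : closes a (A ++ x :: C) -> ipath e (a :: rev C).
Proof.
by move=> /closes_rev; rewrite rev_cat rev_cons cat_rcons => /closes_prefix.
Qed.

Lemma closes_mid a A x C : closes a (A ++ x :: C) -> e a x = nilp A || nilp C.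
Proof.
move=> [iR _ eR]; rewrite eR ?mem_cat ?mem_head ?orbT // last_cat /=.
move/ipath_uniq: iR; rewrite cat_uniq /= => /and3P[_ + /andP[xC _]].
rewrite negb_or => /andP[xA _]; congr (_ || _).
  by case: (A) xA => [|y s] /=; rewrite ?eqxx // inE negb_or => /andP[/negbTE].
case: (C) xC => [|y s] xC /=; first by rewrite eqxx.
by apply/negbTE; apply: contraNneq xC => ->; apply: mem_last.
Qed.

(** * The ways in which the last vertex of an attached path can meet the hole *)

Section Attach.
Variables (a : T) (Q : seq T) (q : T).
Hypothesis iQ : ipath e (a :: rcons Q q).

(** The ends are [a] and the contact [x]; the arms are the attached path and the two sides of the
    hole. *)
Lemma theta_one_contact A x C :
  closes a (A ++ x :: C) -> anti e Q (A ++ x :: C) -> e q x -> q != x ->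
  anti e [:: q] A -> anti e [:: q] C ->
  house_sizes (size Q).+1 (size A) (size C) -> has_theta.
Proof.
move=> cR aQ qx ne_qx qA qC sz; have [iR aR eR] := cR.
have [iA iC aAC] := ipath_mid iR.
exists a, x, (rcons Q q), A, (rev C); split; last by rewrite size_rcons size_rev.
have ax : e a x = nilp A || nilp C by apply: closes_mid.
split.
- by apply: contraNneq aR => ->; rewrite mem_cat mem_head orbT.
- by rewrite ax /nilp size_rcons size_rev.
- by split=> //; [apply: closes_prefix cR | apply: closes_suffix cR].
- split=> //; last by rewrite -rev_cons ipath_rev.
  have [_ _ iQq] := ipath_cons _ _ _ iQ; have := ipath_uniq iQq; rewrite rcons_uniq => /andP[qQ _].
  apply/ipath_rcons; rewrite mem_rcons inE negb_or last_rcons eq_sym ne_qx; split=> //.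
    by apply/negP => xQ; have [] := aQ x x xQ; rewrite ?eqxx // mem_cat mem_head orbT.
  move=> y; rewrite mem_rcons inE => /orP[/eqP->|yQ]; first by rewrite eqxx.
  have [|_ /negbTE->] := aQ y x yQ; first by rewrite mem_cat mem_head orbT.
  by rewrite (negbTE (memPn qQ _ yQ)).
- split.
  + rewrite -cats1; apply: anti_catl => // y z yQ zA; apply: aQ => //.
    by rewrite mem_cat zA.
  + apply: (@anti_eq_mem (Q ++ [:: q]) _ C) => [y|y|]; rewrite ?cats1 ?mem_rev //.
    rewrite -cats1; apply: anti_catl => // y z yQ zC; apply: aQ => //.
    by rewrite mem_cat inE zC !orbT.
  + by apply: anti_eq_mem aAC => // y; rewrite mem_rev.
Qed.

(** The ends are [q] and [x], joined by an edge, through [y], and along [Q], [a] and [A]. Nonempty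
    [C] keeps [y] away from [a]. *)
Lemma theta_two_adjacent_contacts A x y C :
  closes a (A ++ x :: y :: C) -> anti e Q (A ++ x :: y :: C) -> e q x -> e q y ->
  q != x -> q != y -> anti e [:: q] A -> ~~ nilp C -> 0 < size Q + size A -> has_theta.
Proof.
move=> cR aQ qx qy ne_qx ne_qy qA C0 sz; have [iR aR eR] := cR.
have [iA iC aAC] := ipath_mid iR.
have aQ' z : z \in Q -> {in A ++ x :: y :: C, forall w, z != w /\ ~~ e z w}.
  by move=> zQ w wR; apply: aQ.
exists q, x, [::], [:: y], (rev Q ++ a :: A); split; last first.
  by rewrite /house_sizes size_cat /= size_rev; lia.
have /ipath_cons[aQq eaQ iQq] := iQ.
have iaQ : ipath e (a :: Q) by apply: (@ipath_catl _ [:: q]); rewrite cats1.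
have cR' : closes a (rcons A x ++ y :: C) by rewrite cat_rcons.
have /ipath_cons[aA eaA _] := closes_prefix cR.
have /ipath_cons[aAx eaAx _] := closes_prefix cR'.
have xy : e x y by case/ipath_cons: iC => _ -> //; rewrite mem_head.
have ne_xy : x != y by case/ipath_cons: iC; rewrite inE negb_or => /andP[].
split=> //.
- split=> //; first by rewrite /= inE ne_qy qy eqxx.
  have -> : q :: rev Q ++ a :: A = rev (a :: rcons Q q) ++ A.
    by rewrite rev_cons rev_rcons -cats1 -catA.
  apply/ipath_cat; split; rewrite ?ipath_rev //.
    by apply: ipath_catl iR.
  move=> u v; rewrite mem_rev last_rev inE /= => uQ vA.
  have [->|ne_ua] := eqVneq u a.
    by rewrite eaA //; split; [rewrite eq_sym (memPn aA) | case: (A) vA].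
  move: uQ; rewrite (negbTE ne_ua) mem_rcons inE /= => /orP[/eqP->|uQ].
    by have [-> /negbTE->] := qA q v (mem_head _ _) vA.
  by have [|-> /negbTE->] := aQ' _ uQ v; rewrite ?mem_cat ?vA.
- split=> //; first by rewrite /= inE eq_sym ne_xy e_sym xy eqxx.
  have -> : rcons (rev Q ++ a :: A) x = rev (a :: Q) ++ rcons A x.
    by rewrite rev_cons rcons_cat cat_rcons.
  apply/ipath_cat; split; rewrite ?ipath_rev //.
  move=> u v; rewrite mem_rev last_rev inE /= => uQ vA.
  have [->|ne_ua] := eqVneq u a.
    by rewrite eaAx //; split; [rewrite eq_sym (memPn aAx) | case: (A) vA].
  move: uQ; rewrite (negbTE ne_ua) /= => uQ.
  have [|-> /negbTE->] := aQ' _ uQ v; rewrite // -cat_rcons mem_cat vA //.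
- split=> //.
  move=> u v; rewrite inE => /eqP->{u}; rewrite mem_cat mem_rev inE.
  case/or3P => [vQ|/eqP->|vA].
  + have [|ne ne'] := aQ' _ vQ y; first by rewrite mem_cat !inE eqxx !orbT.
    by rewrite eq_sym e_sym.
  + rewrite e_sym (closes_mid cR') negb_or C0 andbT; split; last by case: (A).
    by apply: contraNneq aR => <-; rewrite mem_cat !inE eqxx !orbT.
  + by have [ne ne'] := aAC v y vA (mem_head _ _); rewrite eq_sym e_sym.
Qed.

(** The ends are [a] and [q]; two arms follow the hole from [a] to the outermost contacts [x] and
    [y]. The stretch [M] is discarded, so contacts inside it do no harm, and being nonempty it keeps
    the two arms apart. *)
Lemma theta_two_far_contacts A x M y C :
  closes a (A ++ x :: M ++ y :: C) -> anti e Q (A ++ x :: M ++ y :: C) -> e q x -> e q y ->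
  q \notin A ++ x :: M ++ y :: C ->
  anti e [:: q] A -> anti e [:: q] C -> ~~ nilp M ->
  house_sizes (size Q) (size A).+1 (size C).+1 -> has_theta.
Proof.
move=> cR aQ qx qy qR qA qC M0 sz; have [iR aR eR] := cR.
exists a, q, Q, (rcons A x), (rev (y :: C)); split; last first.
  by rewrite size_rcons size_rev.
have /ipath_cons[aQq eaQ iQq] := iQ.
have iaQ : ipath e (a :: Q) by apply: (@ipath_catl _ [:: q]); rewrite cats1.
have [m [M' eqM]] : exists m M', M = m :: M' by case: (M) M0 => // m M' _; exists m, M'.
have cR1 : closes a (rcons A x ++ m :: (M' ++ y :: C)) by rewrite cat_rcons -cat_cons -eqM.
have cR2 : closes a ((A ++ x :: belast m M') ++ last m M' :: y :: C).
  by rewrite -catA cat_cons -[belast m M' ++ _]cat_rcons -lastI -eqM.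
have [iAxm _ aAx] := ipath_mid (let: And3 i _ _ := cR1 in i).
have iAx : ipath e (rcons A x) by apply: (@ipath_catl _ [:: m]); rewrite cats1.
have iyC : ipath e (y :: C) by move: iR; rewrite -cat_cons catA => /ipath_catr.
have subR z : z \in rcons A x \/ z \in y :: C -> z \in A ++ x :: M ++ y :: C.
  by rewrite mem_rcons !inE mem_cat inE mem_cat inE => -[/orP[]|/orP[]] ->; rewrite ?orbT.
have q_out z : z \in A ++ x :: M ++ y :: C -> q != z by move=> zR; rewrite eq_sym (memPn qR).
split=> //.
- by apply: contraNneq aQq => ->; rewrite mem_rcons mem_head.
- rewrite eaQ ?mem_rcons ?mem_head // /nilp size_rcons size_rev /= !orbF.
  case: (Q) (ipath_uniq iQq) => [|z Q'] /=; first by rewrite eqxx.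
  by rewrite mem_rcons inE negb_or => /andP[/andP[/negbTE]]; rewrite eq_sym.
- by split=> //; [apply: closes_prefix cR1 | apply: closes_suffix cR2].
- split=> //.
    apply/ipath_rcons; split=> //.
      by apply: contra qR => qAx; apply: subR; left.
    move=> z; rewrite mem_rcons inE last_rcons => /orP[/eqP->|zA].
      by rewrite eqxx e_sym.
    have [_] := qA q z (mem_head _ _) zA; rewrite e_sym => /negbTE->.
    have := ipath_uniq iAx; rewrite rcons_uniq => /andP[xA _].
    by rewrite (negbTE (memPn xA _ zA)).
  rewrite -rev_cons ipath_rev //; apply/ipath_cons; split=> //.
    by apply: contra qR => qyC; apply: subR; right.
  move=> z; rewrite inE /= => /orP[/eqP->|zC]; first by rewrite eqxx.
  have [_ /negbTE->] := qC q z (mem_head _ _) zC.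
  by have := ipath_uniq iyC => /andP[yC _]; rewrite (negbTE (memPn yC _ zC)).
- split.
  + by move=> u v uQ vA; apply: aQ => //; apply: subR; left.
  + by move=> u v uQ; rewrite mem_rev => vC; apply: aQ => //; apply: subR; right.
  + by move=> u v uA; rewrite mem_rev => vC; apply: aAx => //; rewrite mem_cat vC orbT.
Qed.

End Attach.

(** From [a] to [q] there are only the one-vertex arms [s], [x] and [y], which [house_sizes]
    rejects. If [q] sees [M], then [q] and [x] are joined by an edge, through [s] and [a], and back
    along [M] from the first neighbour of [q]. Otherwise [x] and [y] are joined through [a], through
    [q], and along [M]. *)
Lemma theta_square a s q x M y :
  ipath e [:: a; s; q] -> closes a (x :: rcons M y) -> anti e [:: s] (x :: rcons M y) ->
  e q x -> e q y -> q \notin x :: rcons M y -> 1 < size M -> has_theta.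
Proof.
move=> iasq cR asR qx qy qR M1; have [iR aR eR] := cR.
have /ipath_cons[a_sq ea _] := iasq.
have iM : ipath e (rcons M y) by case/ipath_cons: iR.
have ixM : ipath e (x :: M) by move: iR; rewrite -cats1 -cat_cons => /ipath_catl.
have /ipath_cons[xMy ex _] := iR; have := ipath_uniq iM; rewrite rcons_uniq => /andP[yM uM].
move: xMy qR; rewrite !inE !mem_rcons !inE !negb_or => /andP[ne_xy xM] /and3P[ne_qx ne_qy qM].
move: a_sq; rewrite !inE negb_or => /andP[ne_as ne_aq].
have aq : e a q = false.
  rewrite ea ?inE ?eqxx ?orbT //=; move: (ipath_uniq iasq); rewrite /= [s \in _]inE.
  by case/and3P => _ /negbTE; rewrite eq_sym.
have sq : e s q by case/ipath_cons: iasq => _ _ /ipath_cons[_ -> //]; rewrite mem_head.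
have as_ : e a s by rewrite ea ?mem_head.
have ne_sq : s != q by have := ipath_uniq iasq; rewrite /= [s \in _]inE => /and3P[].
have eaR z : z \in x :: rcons M y -> e a z = (z == x) || (z == y).
  by move=> zR; rewrite eR //= last_rcons.
have ax : e a x by rewrite eaR ?mem_head ?eqxx.
have ay : e a y by rewrite eaR ?eqxx ?orbT // inE mem_rcons mem_head orbT.
have ne_a z : z \in x :: rcons M y -> a != z by move=> zR; rewrite eq_sym (memPn aR).
have xR : x \in x :: rcons M y by rewrite mem_head.
have yR : y \in x :: rcons M y by rewrite inE mem_rcons mem_head orbT.
have MR z : z \in M -> z \in x :: rcons M y by rewrite inE mem_rcons inE => ->; rewrite !orbT.
have aM z : z \in M -> ~~ e a z.
  by move=> zM; rewrite eaR ?MR // negb_or (memPn xM) ?(memPn yM).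
have sR z : z \in x :: rcons M y -> s != z /\ ~~ e s z by apply: asR; rewrite mem_head.
have [qM1|qM0] := boolP (has (e q) M).
  have [N [h [N' [eqM qh qN]]]] := has_split_first qM1.
  have NM z : z \in rcons N h -> z \in M by rewrite eqM -cat_rcons mem_cat => ->.
  have ixN : ipath e (x :: rcons N h).
    by move: ixM; rewrite eqM -cat_rcons -cat_cons => /ipath_catl.
  have iN : ipath e (rcons N h) by case/ipath_cons: ixN.
  have hN : h \notin N by have := ipath_uniq iN; rewrite rcons_uniq => /andP[].
  exists q, x, [::], [:: s; a], (rev (rcons N h)); split; last first.
    by rewrite size_rev size_rcons.
  split=> //.
  - split=> //; first by rewrite -[[:: q; s; a]]/(rev [:: a; s; q]) ipath_rev.
    rewrite -rev_rcons ipath_rev //; apply/ipath_rcons; split=> //.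
      by apply: contra qM => /NM.
    move=> z; rewrite mem_rcons inE last_rcons => /orP[/eqP->|zN]; first by rewrite eqxx e_sym.
    rewrite (negbTE (memPn hN _ zN)); apply/negbTE; rewrite e_sym.
    by apply: contra qN => qz; apply/hasP; exists z.
  - split=> //; last by rewrite -rev_cons ipath_rev.
    have [ne_sx sx] := sR _ xR.
    apply/ipath_cons; split.
    + by rewrite !inE negb_or eq_sym ne_as.
    + move=> v; rewrite !inE => /orP[] /eqP->; first by rewrite e_sym as_ eqxx.
      by rewrite (negbTE sx) /= eq_sym (negbTE (ne_a _ xR)).
    + by rewrite /= inE ne_a //= ax eqxx.
  - split=> // u v; rewrite mem_rev inE => /orP[/eqP->|]; last rewrite inE => /eqP->.
      by move=> /NM/MR/sR.
    by move=> /NM vM; split; [apply/ne_a/MR | apply: aM].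
exists x, y, [:: a], [:: q], M; split; last by rewrite /house_sizes /= M1.
split=> //.
- rewrite ex ?mem_rcons ?mem_head //=; case: (M) M1 yM => //= z M' _.
  by rewrite inE negb_or => /andP[/negbTE-> _].
- by split=> //; rewrite /= inE eq_sym ?ne_a ?ne_qx // e_sym ?ax ?qx eqxx.
- by split=> //; rewrite /= inE ?ne_a ?ne_qy ?ay ?qy ?eqxx.
- split=> u v; rewrite inE => /eqP->.
  + by rewrite inE => /eqP->; rewrite ne_aq aq.
  + by move=> vM; split; [apply/ne_a/MR | apply: aM].
  + move=> vM; split; first by rewrite eq_sym (memPn qM).
    by apply: contra qM0 => qv; apply/hasP; exists v.
Qed.

(* Every way for the path from [a] to reach the rest of the hole [a :: R] yields a theta. *)
Lemma theta_attach a Q q R :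
  closes a R -> 3 < size R -> ipath e (a :: rcons Q q) -> anti e Q R -> q \notin R ->
  has (e q) R -> (nilp Q -> ~~ e q (head q R) && ~~ e q (last q R)) -> has_theta.
Proof.
move=> cR R4 iQ aQ qR /has_split_first[A [x [B [eqR qx qA]]]] Q0.
have antiq s : ~~ has (e q) s -> {subset s <= R} -> anti e [:: q] s.
  move=> /hasPn qs sR u v; rewrite inE => /eqP-> vs; split; last exact: qs.
  by rewrite eq_sym (memPn qR) ?sR.
have AR : {subset A <= R} by move=> z; rewrite eqR mem_cat => ->.
(* If [x] is the only contact and [Q] is empty, then [x] is not an end of [R], so both sides are
   nonempty, and four vertices in [R] leave two for one of them. *)
have [qB|qB] := boolP (has (e q) B); last first.
  have BR : {subset B <= R} by move=> z zB; rewrite eqR mem_cat inE zB !orbT.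
  rewrite eqR in cR aQ; apply: (theta_one_contact iQ cR aQ qx _ (antiq A qA AR) (antiq B qB BR)).
    by rewrite eq_sym (memPn qR) // eqR mem_cat mem_head orbT.
  move: R4 Q0; rewrite eqR size_cat /house_sizes /= last_cat /=.
  case: Q {iQ aQ} => [|? ?] /=; last by lia.
  case: A {cR antiq AR qA eqR} => [|z A] /=; first by rewrite qx => _ /(_ isT).
  by case: B {qB BR} => [|z' B] /=; [rewrite qx andbF => _ /(_ isT) | lia].
(* The vertex [y] is the last contact; nothing is assumed about those between [x] and [y]. *)
move: qB; rewrite -has_rev => /has_split_first[C' [y [M' [eqB qy qC]]]].
have {}eqB : B = rev M' ++ y :: rev C'.
  by rewrite -[B]revK eqB rev_cat rev_cons cat_rcons.
move: qC eqB; rewrite -has_rev; move: (rev C') (rev M') => C M qC eqB; rewrite {B}eqB in eqR.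
have CR : {subset C <= R}.
  by move=> z zC; rewrite eqR mem_cat inE mem_cat inE zC !orbT.
have [M0|M0] := boolP (nilp M).
  move: M0 eqR => /nilP -> /= eqR.
  have ne_qx : q != x by rewrite eq_sym (memPn qR) // eqR mem_cat mem_head orbT.
  have ne_qy : q != y by rewrite eq_sym (memPn qR) // eqR mem_cat !inE eqxx !orbT.
  have [C0|C0] := boolP (nilp C); last first.
    rewrite eqR in cR aQ; apply: (theta_two_adjacent_contacts iQ cR aQ) => //; first exact: antiq.
    by move: Q0; rewrite eqR; case: (Q) => [|? ?]; case: (A) => [|? ?] //=; rewrite qx => /(_ isT).
  move: C0 eqR => /nilP -> eqR.
  (* The contacts are the last two vertices of [R]. Traversed backwards, the hole has a nonempty
     remainder after them. *)
  have eq_rev : rev R = [::] ++ y :: x :: rev A by rewrite eqR rev_cat.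
  have cR' := closes_rev cR; rewrite eq_rev in cR'.
  have aQ' : anti e Q ([::] ++ y :: x :: rev A).
    by rewrite -eq_rev => u v uQ; rewrite mem_rev; apply: aQ.
  apply: (theta_two_adjacent_contacts iQ cR' aQ') => //.
    by move: R4; rewrite eqR size_cat /nilp size_rev /=; lia.
  by move: Q0; rewrite eqR last_cat /=; case: (Q) => //= /(_ isT); rewrite qy andbF.
have [sz|sz] := boolP (house_sizes (size Q) (size A).+1 (size C).+1).
  rewrite eqR in cR aQ qR; apply: (theta_two_far_contacts iQ cR aQ) => //; exact: antiq.
(* The sizes fail only if [A] and [C] are empty and [Q] has at most one vertex; an empty [Q] would
   forbid contacts at both ends of [R]. *)
have [sQ [sA sC]] : size Q = 1 /\ size A = 0 /\ size C = 0.
  have : nilp Q -> ~~ nilp A && ~~ nilp C.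
    move=> /Q0; rewrite eqR last_cat /= last_cat /= => /andP[hd lt].
    apply/andP; split.
      by apply: contraNN hd => /nilP->; rewrite /= qx.
    by apply: contraNN lt => /nilP->; rewrite /= qy.
  by move: sz; rewrite /nilp /house_sizes; clear; case: (size Q) => [|[|n]]; lia.
move: sA sC sQ => /size0nil A0 /size0nil C0; rewrite {}A0 {}C0 /= in eqR.
case: Q iQ aQ {Q0 sz} => [|s [|//]] //= iQ aQ _.
rewrite cats1 in eqR; rewrite eqR in cR aQ qR.
apply: (theta_square iQ cR aQ qx qy qR).
by move: R4; rewrite eqR /= size_rcons.
Qed.
End FindTheta.

(** * Witnesses *)

Lemma ipath_path (T : eqType) (e : rel T) x s : ipath e (x :: s) -> path e x s.
Proof.
elim: s x => //= y s IH x /and3P[_ /andP[/eqP xy _] iys].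
by rewrite xy eqxx; apply: IH.
Qed.

Lemma ipath_neighbor (T : eqType) (e : rel T) x s : symmetric e ->
  ipath e s -> 1 < size s -> x \in s -> has (e x) s.
Proof.
move=> e_sym is1 s1 /splitPr xs; case: xs is1 s1 => A B.
case: B => [|b B]; last first.
  by move=> /ipath_catr/ipath_path/andP[xb _] _; rewrite has_cat /= xb !orbT.
case/lastP: A => // A y; rewrite cat_rcons => /ipath_catr/ipath_path/andP[yx _] _.
by rewrite has_cat /= e_sym yx orbT.
Qed.

(** Built from the far end: if [x] is already on the induced path, the part before it is cut off;
    otherwise [x] is joined to its last neighbour there. *)
Lemma ipath_of_path (T : eqType) (e : rel T) x p : symmetric e -> path e x p ->
  exists p', [/\ ipath e (x :: p'), {subset p' <= p} & last x p' = last x p].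
Proof.
move=> e_sym; elim: p x => [|y p IH] x /=; first by exists [::].
move=> /andP[xy /IH[p1 [ip1 sp1 lp1]]].
have sub1 w : w \in y :: p1 -> w \in y :: p.
  by rewrite !inE => /orP[->//|/sp1 ->]; rewrite orbT.
have [xp|xp] := boolP (x \in y :: p1).
  have [s1 [s2 eqp]] : exists s1 s2, y :: p1 = s1 ++ x :: s2.
    by case/splitPr: xp => s1 s2; exists s1, s2.
  exists s2; split.
  - by rewrite eqp in ip1; apply: ipath_catr ip1.
  - by move=> w ws; apply: sub1; rewrite eqp mem_cat inE ws !orbT.
  - by rewrite -lp1 -[last y p1]/(last x (y :: p1)) eqp last_cat.
have : has (e x) (rev (y :: p1)) by rewrite has_rev /= xy.
move=> /has_split_first[C [z [B [eqC xz nC]]]].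
have {}eqC : y :: p1 = rev B ++ z :: rev C.
  by rewrite -[LHS]revK eqC rev_cat rev_cons cat_rcons.
have sub w : w \in z :: rev C -> w \in y :: p1 by rewrite eqC mem_cat => ->; rewrite orbT.
exists (z :: rev C); split.
- apply/ipath_cons; split; first by apply: contra xp => /sub.
    move=> w; rewrite inE /= => /orP[/eqP->|]; first by rewrite eqxx.
    rewrite mem_rev => wC; have /hasPn/(_ _ wC)/negbTE-> := nC.
    rewrite eqC in ip1; have /ipath_uniq := ipath_catr ip1.
    by rewrite /= mem_rev => /andP[zC _]; rewrite (negbTE (memPn zC _ wC)).
  by rewrite eqC in ip1; apply: ipath_catr ip1.
- by move=> w /sub/sub1.
- by rewrite -lp1 -[last y p1]/(last x (y :: p1)) eqC last_cat.
Qed.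

(** Only the target of a step is constrained, so the start is exempt from [P]; this lets a path
    begin at a neighbour of [a] and avoid all others. *)
Lemma connect_ipath (T : finType) (e r : rel T) (P : pred T) x y : symmetric e ->
  (forall u v, r u v -> e u v && P v) -> connect r x y ->
  exists p, [/\ ipath e (x :: p), last x p = y & {in p, forall v, P v}].
Proof.
move=> e_sym r_sub /connectP[p rp ->].
have [|p' [ip' sp' lp']] := @ipath_of_path _ e x p e_sym.
  by apply: sub_path rp => u v /r_sub/andP[].
exists p'; split=> // v /sp' vp; apply: (allP _ v vp).
elim: p x rp {ip' sp' lp' vp} => //= u p IH x /andP[/r_sub/andP[_ Pu] /IH].
by rewrite Pu.
Qed.

Lemma ipath_connect (T : finType) (e r : rel T) x y s : ipath e (x :: s) -> last x s = y ->
  (forall u v, v \in s -> e u v -> r u v) -> connect r x y.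
Proof.
move=> /ipath_path es <- rs; apply/connectP; exists s => //.
elim: s x es rs => //= z s IH x /andP[xz zs] rs; apply/andP; split.
  by apply: rs; rewrite ?mem_head.
by apply: IH => // u v vs; apply: rs; rewrite inE vs orbT.
Qed.

Section Witnesses.
Variable G : sgraph.
Implicit Types a b c d s t w z u v : G.

(* The cycle [a b c d] (the triangle [a b d] if [b = c]) with a long third path from [a] to [d]. *)
Definition short_witness a d b c s t : bool :=
  [&& adj a d, adj a b, adj c d, (b == c) || [&& adj b c, ~~ adj b d & ~~ adj c a],
      adj a s, adj d t, ~~ adj s b, ~~ adj s c, ~~ adj s d, ~~ adj t a, ~~ adj t b, ~~ adj t c
    & connect (fun x y => adj x y &&
        ((y == t) || [&& ~~ adj y a, ~~ adj y b, ~~ adj y c & ~~ adj y d])) s t].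

(* [a1 a a2 w] extends to an induced cycle of length at least 5, to which a path starting
   with [a s] and ending next to [a2] is attached. *)
Definition long_witness a a1 a2 w s z : bool :=
  [&& adj a a1, adj a a2, adj a s, adj a2 w, adj a2 z, ~~ adj a1 a2, ~~ adj s a1, ~~ adj s a2,
      s != a1, s != a2, ~~ adj w a, ~~ adj w a1, w != a, w != a1,
      connect (fun x y => adj x y && ((y == a1) || ~~ adj y a && ~~ adj y a2)) w a1
    & connect (fun x y => [&& adj x y, ~~ adj y a & y != a]) s z].

Let sym := @adj_sym G.
Let irr := @adj_irrefl G.

Lemma adj_neq u v w : adj u v -> ~~ adj u w -> w != v.
Proof. by move=> uv; apply: contraNneq => ->. Qed.

Lemma adj_neq0 u v : adj u v -> u != v.
Proof. by apply: contraTneq => ->; rewrite irr. Qed.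

(** The ends are [a] and [d], with the edge, the guessed arm and the found path as arms. After [s]
    only [t] may see any of the four guessed vertices, and it sees only [d]; as [s != t], the third
    arm has at least two vertices. *)
Lemma short_witness_theta a d b c s t :
  short_witness a d b c s t -> has_theta (@adj G).
Proof.
move=> /and5P[ad ab cd bc /and5P[as_ dt sb sc /and5P[sd ta tb tc con]]].
have [|p [isp lp Pp]] := connect_ipath (e := @adj G) (P := fun y => (y == t) ||
  [&& ~~ adj y a, ~~ adj y b, ~~ adj y c & ~~ adj y d]) sym _ con; first by [].
have bt : b != t by rewrite eq_sym; apply: (adj_neq ab); rewrite sym.
have ba : adj b a by rewrite sym.
have da : adj d a by rewrite sym.
have dc : adj d c by rewrite sym.
have at_ : ~~ adj a t by rewrite sym.
have ct : c != t.
  have [<-//|ne_bc /=] := eqVneq b c.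
  move: bc; rewrite (negbTE ne_bc) => /and3P[bc _ _].
  by apply: contraNneq tb => <-; rewrite sym.
have ne_sc : s != c by apply: (adj_neq dc); rewrite sym.
have ne_sb : s != b.
  have [->//|ne_bc] := eqVneq b c.
  move: bc; rewrite (negbTE ne_bc) [adj b c]sym => /and3P[cb _ _].
  by apply: (adj_neq cb); rewrite sym.
have ne_st : s != t by apply: contraNneq ta => <-; rewrite sym.
have sp v : v \in p -> v != s.
  by have := ipath_uniq isp => /= /andP[sp _] vp; apply: contraNneq sp => <-.
have Pp' v : v \in p -> v != t ->
    [/\ adj a v = false, adj b v = false, adj c v = false & adj d v = false].
  by move=> /Pp; rewrite ![adj _ v]sym => /orP[->//|/and4P[/negbTE-> /negbTE-> /negbTE-> /negbTE->]].
have Pspp v : v \in s :: p -> [/\ v != a, v != d, v != b, v != c & ~~ adj b v && ~~ adj c v].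
  rewrite inE => /orP[/eqP->|vp].
    split=> //; rewrite 1?eq_sym ?(adj_neq0 as_) //; last by rewrite ![adj _ s]sym sb.
    by rewrite eq_sym; apply: (adj_neq cd); rewrite sym.
  have [->|ne_vt] := eqVneq v t.
    split; rewrite 1?[t == _]eq_sym ?bt ?ct ?(adj_neq0 dt) //; last by rewrite ![adj _ t]sym tb.
    by rewrite eq_sym; apply: (adj_neq ba); rewrite sym.
  have [av bv cv dv] := Pp' _ vp ne_vt; split; last by rewrite bv cv.
  - by apply: (adj_neq ba); rewrite bv.
  - by apply: (adj_neq ad); rewrite av.
  - by apply: (adj_neq ab); rewrite av.
  - by apply: (adj_neq dc); rewrite dv.
have Pa v : v \in s :: p -> adj a v = (v == s).
  rewrite inE => /orP[/eqP->|vp]; first by rewrite eqxx.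
  rewrite (negbTE (sp _ vp)); have [->|ne_vt] := eqVneq v t; first exact: negbTE.
  by case: (Pp' _ vp ne_vt).
have Pd v : v \in s :: p -> adj d v = (v == t).
  rewrite inE => /orP[/eqP->|vp]; first by rewrite sym (negbTE sd) (negbTE ne_st).
  by have [->//|ne_vt] := eqVneq v t; case: (Pp' _ vp ne_vt).
have p0 : 0 < size p by case: (p) lp => //= st; rewrite st eqxx in ne_st.
have qP : b = c \/ [/\ b != c, adj b c, ~~ adj b d & ~~ adj a c].
  have [|ne_bc] := eqVneq b c; first by left.
  by move: bc; rewrite (negbTE ne_bc) /= [adj c a]sym => /and3P[]; right.
have td : adj t d by rewrite sym.
have sa : adj s a by rewrite sym.
have ne_bd : b != d := adj_neq td tb.
have ne_ca : c != a := adj_neq sa sc.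
pose q := if b == c then [:: b] else [:: b; c].
exists a, d, [::], q, (s :: p); split; last first.
  by rewrite /house_sizes /q; case: eqP => _ /=; rewrite ?ltnS ?p0.
split.
- exact: adj_neq0.
- by rewrite ad.
- split=> //; last first.
    apply/ipath_cons; split=> //.
    by apply/negP => /Pspp[]; rewrite eqxx.
  rewrite /q; case: qP => [eq_bc|[ne_bc adj_bc bd ac]].
    by rewrite -eq_bc eqxx /= inE (adj_neq0 ab) ab eqxx.
  rewrite (negbTE ne_bc) /= !inE negb_or (adj_neq0 ab) eq_sym ne_ca ab adj_bc (negbTE ac).
  by rewrite !eqxx [c == b]eq_sym (negbTE ne_bc).
- split=> //; last first.
    apply/(ipath_rcons sym); split=> //; last by move=> v /Pd; rewrite sym /= lp.
    by apply/negP => /Pspp[_]; rewrite eqxx.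
  rewrite /q; case: qP => [eq_bc|[ne_bc adj_bc bd ac]].
    by rewrite eq_bc eqxx /= inE (adj_neq0 cd) cd eqxx.
  rewrite (negbTE ne_bc) /= !inE negb_or ne_bc ne_bd adj_bc (negbTE bd) cd !eqxx (adj_neq0 cd).
  by rewrite [d == c]eq_sym (negbTE (adj_neq0 cd)).
- split=> // u v uq /Pspp[_ _ ne_vb ne_vc /andP[vb vc]].
  move: uq; rewrite /q; case: eqP => _; rewrite !inE.
    by move=> /eqP->; rewrite eq_sym.
  by move=> /orP[] /eqP->; rewrite eq_sym.
Qed.

(** The first reachability test closes the hole. The path of the second one is cut at its first
    vertex with a neighbour on the hole, and [theta_attach] treats whatever contacts that vertex
    has. *)
Lemma long_witness_theta a a1 a2 w s z :
  long_witness a a1 a2 w s z -> has_theta (@adj G).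
Proof.
move=> /and5P[aa1 aa2 as_ a2w /and5P[a2z a12 sa1 sa2 /and5P[ne_sa1 ne_sa2 wa wa1]]].
move=> /and4P[ne_wa ne_wa1 con1 con2].
have [|p [iwp lp Pp]] := connect_ipath (e := @adj G)
  (P := fun y => (y == a1) || ~~ adj y a && ~~ adj y a2) sym _ con1; first by [].
pose R := a2 :: w :: p.
have Pp' v : v \in p -> v != a1 -> adj a v = false /\ adj a2 v = false.
  by move=> /Pp; rewrite ![adj _ v]sym => /orP[->//|/andP[/negbTE-> /negbTE->]].
have wa2 : adj w a2 by rewrite sym.
have ne_a12 : a1 != a2 := adj_neq wa2 wa1.
have a2a : adj a2 a by rewrite sym.
have wR v : v \in w :: p -> v != a /\ v != a2.
  rewrite inE => /orP[/eqP->|vp]; first by rewrite ne_wa eq_sym (adj_neq0 a2w).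
  have [->|ne_v] := eqVneq v a1; first by rewrite ne_a12 eq_sym (adj_neq0 aa1).
  have [av a2v] := Pp' _ vp ne_v.
  by split; [apply: (adj_neq a2a); rewrite a2v | apply: (adj_neq aa2); rewrite av].
have wp v : v \in p -> v != w.
  by have := ipath_uniq iwp => /= /andP[wp _] vp; apply: contraNneq wp => <-.
have eaR v : v \in R -> adj a v = (v == a2) || (v == a1).
  rewrite inE => /orP[/eqP->|vwp]; first by rewrite eqxx.
  have [_ /negbTE->] := wR _ vwp; move: vwp; rewrite inE => /orP[/eqP->|vp].
    by rewrite sym (negbTE wa) (negbTE ne_wa1).
  by have [->//|ne_v] := eqVneq v a1; case: (Pp' _ vp ne_v).
have cR : closes (@adj G) a R.
  split.
  - apply/ipath_cons; split=> //; first by apply/negP=> /wR[_]; rewrite eqxx.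
    move=> v; rewrite inE /= => /orP[/eqP->|vp]; first by rewrite eqxx.
    rewrite (negbTE (wp _ vp)); have [->|ne_v] := eqVneq v a1; last by case: (Pp' _ vp ne_v).
    by rewrite sym (negbTE a12).
  - rewrite inE negb_or (adj_neq0 aa2) /=.
    by apply/negP => /wR[]; rewrite eqxx.
  - by move=> v /eaR; rewrite /R /= lp.
(* Since [w] is neither equal nor adjacent to [a1], at least two vertices follow it. *)
have R4 : 3 < size R.
  rewrite /R /=; case: (p) lp iwp => [|v [|v' p']] //= lp; first by rewrite lp eqxx in ne_wa1.
  by rewrite lp eqxx => /and3P[_ /andP[/eqP wa1']]; rewrite wa1' in wa1.
have sR : s \notin R.
  by apply: contraL as_ => /eaR->; rewrite negb_or ne_sa2 ne_sa1.
have [|zp [izp zl zP]] := connect_ipath (e := @adj G)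
    (P := fun v => ~~ adj v a && (v != a)) sym _ con2; first by [].
(* The path ends at [z], which sees [a2], so it does touch the hole. *)
have : has (fun v => has (adj v) R) (s :: zp).
  apply/hasP; exists z; first by rewrite -zl mem_last.
  by apply/hasP; exists a2; rewrite ?mem_head // sym.
move=> /has_split_first[F [q [F' [eqF qR nF]]]].
have iFq : ipath (@adj G) (rcons F q).
  by move: izp; rewrite eqF -cat_rcons => /ipath_catl.
have szp : rcons F q = s :: behead (rcons F q) by case: (F) eqF => [|? ?] [->].
have Fq_zp v : v \in behead (rcons F q) -> v \in zp.
  have -> : zp = behead (rcons F q) ++ F' by case: (F) eqF => [|? ?] [_ ->]; rewrite //= cat_rcons.
  by rewrite mem_cat => ->.
have FR u v : u \in F -> v \in R -> ~~ adj u v.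
  by move=> uF vR; apply: contra nF => uv; apply/hasP; exists u => //; apply/hasP; exists v.
apply: (@theta_attach _ (@adj G) sym a F q R) => //.
- apply/ipath_cons; split=> //.
    rewrite szp inE negb_or (adj_neq0 as_); apply/negP => /Fq_zp/zP.
    by rewrite eqxx andbF.
  move=> v; rewrite szp /= inE => /orP[/eqP->|vz]; first by rewrite eqxx.
  have := ipath_uniq izp => /andP[szp' _]; have vzp := Fq_zp _ vz.
  by have /andP[va _] := zP _ vzp; rewrite sym (negbTE va) (negbTE (memPn szp' _ vzp)).
(* Every vertex of [R] has a neighbour in [R], so a vertex of [F] on [R] would be an earlier
   contact. *)
- move=> u v uF vR; split; last exact: FR.
  apply: contraTneq uF => uv; apply: contra nF => uF; apply/hasP; exists u => //.
  by rewrite uv; apply: ipath_neighbor => //; case: cR.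
- case/lastP: (F) eqF iFq FR => [[<- _]//|F0 u].
  move=> _ + FR0; rewrite -cats1 cat_rcons => /ipath_catr/ipath_path/andP[uq _].
  by apply/negP => qR'; have := FR0 u q; rewrite mem_rcons mem_head uq => /(_ isT qR').
- case: (F) eqF => // -[<- _] _.
  by rewrite /R /= lp sa2.
Qed.

End Witnesses.

(** * Every theta of the required sizes contains a witness *)

Section Completeness.
Variable G : sgraph.
Implicit Types (a d : G) (p q r : seq G).

Definition has_witness : Prop :=
  (exists a d b c s t : G, short_witness a d b c s t) \/
  (exists a a1 a2 w s z : G, long_witness a a1 a2 w s z).

Let sym := @adj_sym G.

Lemma theta_arm a d p q r : theta (@adj G) a d p q r ->
  [/\ {in p, forall v, adj a v = (v == head a p)}, {in p, forall v, adj v d = (v == last d p)},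
      a \notin p, d \notin p & uniq p].
Proof.
move=> [_ _ [/ipath_cons[ap ea ip] _ _] [/(ipath_rcons sym)[dp ed _] _ _] _].
by split=> //; apply: ipath_uniq ip.
Qed.

Lemma chord_short_witness a d q r : theta (@adj G) a d [::] q r ->
  0 < size q <= 2 -> 1 < size r -> has_witness.
Proof.
move=> th; have [qa qd aq dq uq] := theta_arm (theta_swap12 sym th).
have [ra rd ar dr ur] := theta_arm (theta_swap12 sym (theta_swap23 sym th)).
have [_ ad [_ /ipath_cons[_ _ iq] /ipath_cons[_ _ ir]] _ [_ _ an]] := th.
have {}ad : adj a d by rewrite ad.
case: q th qa qd aq dq uq iq an => [//|b q] th qa qd aq dq uq iq an szq.
case: r th ra rd ar dr ur ir an => [//|s r] th ra rd ar dr ur ir an szr.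
set c := last b q; set t := last s r.
have cq : c \in b :: q by apply: mem_last.
have bq : b \in b :: q by apply: mem_head.
have sr : s \in s :: r by apply: mem_head.
have tr : t \in s :: r by apply: mem_last.
have ne_ts : (t == s) = false.
  case: r szr @t {tr sr an ir dr ar ra rd th} ur => [//|y r] _ t /= /andP[sr _].
  by rewrite (negbTE (memPn sr t (mem_last y r))).
have vs v : v \in r -> (v == s) = false.
  by move=> vr; case/andP: ur => sr' _; rewrite (negbTE (memPn sr' _ vr)).
left; exists a, d, b, c, s, t; apply/and5P; split; rewrite ?ad //.
- by rewrite qa //= eqxx.
- by rewrite qd //= eqxx.
- case: q szq @c {aq dq cq an th bq} qa qd uq iq => [|y [|//]] /= _; rewrite ?eqxx // => qa qd.
  rewrite inE andbT => ne_by /andP[_ /andP[/andP[/eqP by_ _] _]].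
  rewrite by_ qd ?mem_head // sym qa ?inE ?eqxx ?orbT //.
  by rewrite [y == b]eq_sym (negbTE ne_by).
apply/and5P; split.
- by rewrite ra //= eqxx.
- by rewrite sym rd //= eqxx.
- by rewrite sym; have [] := an _ _ bq sr.
- by rewrite sym; have [] := an _ _ cq sr.
apply/and5P; split.
- by rewrite rd //= eq_sym ne_ts.
- by rewrite sym ra //= ne_ts.
- by rewrite sym; have [] := an _ _ bq tr.
- by rewrite sym; have [] := an _ _ cq tr.
apply: (ipath_connect ir erefl) => u v vr uv; rewrite uv /=.
have vr' : v \in s :: r by rewrite inE vr orbT.
rewrite [adj v a]sym ra //= vs // rd //=.
case: (v == t) => //=.
by have [_] := an _ _ bq vr'; have [_] := an _ _ cq vr'; rewrite ![adj v _]sym => -> ->.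
Qed.

(** The hole consists of the edge [ad] and the arm [r], whose three vertices give it length at least
    5. Here [a2] is [d], and the attached path is [q], whose first vertex misses [d] because [q] has
    a second one. *)
Lemma chord_long_witness a d q r : theta (@adj G) a d [::] q r ->
  1 < size q -> 2 < size r -> has_witness.
Proof.
move=> th; have [qa qd aq dq uq] := theta_arm (theta_swap12 sym th).
have [ra rd ar dr ur] := theta_arm (theta_swap12 sym (theta_swap23 sym th)).
have [_ ad [_ /ipath_cons[_ _ iq] /ipath_cons[_ _ ir]] _ [_ _ an]] := th.
have {}ad : adj a d by rewrite ad.
case: q th qa qd aq dq uq iq an => [//|s q] th qa qd aq dq uq iq an szq.
case: r th ra rd ar dr ur ir an => [//|a1 r] th ra rd ar dr ur ir an szr.
have [r' [w eqr]] : exists r' w, r = rcons r' w.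
  by case/lastP: r szr {th ra rd ar dr ur ir an} => // r' w _; exists r', w.
subst r; set z := last s q.
have sq : s \in s :: q by apply: mem_head.
have zq : z \in s :: q by apply: mem_last.
have a1r : a1 \in a1 :: rcons r' w by apply: mem_head.
have wr : w \in a1 :: rcons r' w by rewrite inE mem_rcons mem_head orbT.
have last_r : last d (a1 :: rcons r' w) = w by rewrite /= last_rcons.
rewrite last_r in rd.
have ne_wa1 : (w == a1) = false.
  by case/andP: ur => a1r' _; rewrite (negbTE (memPn a1r' _ _)) // mem_rcons mem_head.
have [ne_sa1 sa1] := an _ _ sq a1r.
right; exists a, a1, d, w, s, z; apply/and5P; split; rewrite ?ad //.
- by rewrite ra //= eqxx.
- by rewrite qa //= eqxx.
- by rewrite sym rd // eqxx.
apply/and5P; split=> //.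
- by rewrite sym qd //= eqxx.
- by rewrite rd // eq_sym ne_wa1.
- rewrite qd //=; case/andP: uq; case: q {th qa qd aq dq iq an sq} szq @z zq => // y q _ z _ sq _.
  by rewrite eq_sym (memPn sq z (mem_last y q)).
apply/and5P; split=> //.
- by apply: contraNneq dq => <-.
- by rewrite sym ra //= ne_wa1.
- rewrite sym; case/ipath_cons: ir => _ -> //; last by rewrite mem_rcons mem_head.
  case: r' szr {th ra rd ar dr an a1r wr last_r} ur => //= y r' _ /and3P[_ yr _].
  by move=> _; apply: contraNneq yr => <-; rewrite mem_rcons mem_head.
apply/and4P; split.
- by apply: contraNneq ar => <-.
- by rewrite ne_wa1.
- have : ipath (@adj G) (rev (a1 :: rcons r' w)) by rewrite ipath_rev.
  rewrite rev_cons rev_rcons rcons_cons => irev.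
  apply: (ipath_connect irev (last_rcons _ _ _)) => u v; rewrite mem_rcons inE mem_rev => vr uv; rewrite uv /=.
  case/orP: vr => [->//|vr'].
  have vr : v \in a1 :: rcons r' w by rewrite inE mem_rcons inE vr' !orbT.
  rewrite [adj v a]sym ra // rd //=; case: (v == a1) => //=.
  move: ur; rewrite cons_uniq rcons_uniq => /and3P[_ wr' _].
  by rewrite (negbTE (memPn wr' _ vr')).
- apply: (ipath_connect iq erefl) => u v vq uv; rewrite uv.
  have vq' : v \in s :: q by rewrite inE vq orbT.
  rewrite [adj v a]sym qa //=; case/andP: uq => sq' _; rewrite (negbTE (memPn sq' _ vq)) /=.
  by apply: contraNneq aq => <-.
Qed.

(** The hole consists of [q] and [r], closed from [w] along [r] to [d] and back along [q]. For
    [z = w] the second test is met by following [p] to [d] and then [r] backwards; it does not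
    matter that this runs along the hole. *)
Lemma theta_long_witness a d p q r : theta (@adj G) a d p q r ->
  ~~ nilp p -> ~~ nilp q -> 1 < size r -> has_witness.
Proof.
move=> th; have [pa pd ap dp up] := theta_arm th.
have [qa qd aq dq uq] := theta_arm (theta_swap12 sym th).
have [ra rd ar dr ur] := theta_arm (theta_swap12 sym (theta_swap23 sym th)).
have [ne_ad ad _ [ip iq ir] [apq apr aqr]] := th.
case: p th pa pd ap dp up ip ad apq apr => [//|s p] th pa pd ap dp up ip ad apq apr _.
case: q th qa qd aq dq uq iq ad apq aqr => [//|a1 q] th qa qd aq dq uq iq ad apq aqr _.
case: r th ra rd ar dr ur ir ad apr aqr => [//|a2 [//|w r]] th ra rd ar dr ur ir ad apr aqr _.
move: ad => /= ad.
have a1q : a1 \in a1 :: q by apply: mem_head.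
have sp : s \in s :: p by apply: mem_head.
have a2r : a2 \in [:: a2, w & r] by apply: mem_head.
have wr : w \in [:: a2, w & r] by rewrite !inE eqxx orbT.
have ne_a2 v : v \in w :: r -> (v == a2) = false.
  by move=> vr; case/andP: ur => a2r' _; rewrite (negbTE (memPn a2r' _ vr)).
have /ipath_cons[_ ea2 iwr] := ir.
have da : adj d a = false by rewrite sym.
right; exists a, a1, a2, w, s, w; apply/and5P; split=> //.
- by rewrite qa //= eqxx.
- by rewrite ra //= eqxx.
- by rewrite pa //= eqxx.
- by rewrite ea2 ?mem_head //= eqxx.
apply/and5P; split=> //.
- by rewrite ea2 ?mem_head //= eqxx.
- by have [] := aqr _ _ a1q a2r.
- by have [] := apq _ _ sp a1q.
- by have [] := apr _ _ sp a2r.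
apply/and5P; split=> //.
- by have [] := apq _ _ sp a1q.
- by have [] := apr _ _ sp a2r.
- by rewrite sym ra //= ne_a2 ?mem_head.
- by rewrite sym; have [] := aqr _ _ a1q wr.
have in_r v : v \in w :: r -> v \in [:: a2, w & r] by rewrite [_ \in a2 :: _]inE orbC => ->.
have ra' v : v \in w :: r -> adj v a = false by move=> vr; rewrite sym ra ?in_r //= ne_a2.
have a2' v : v \in rcons r d -> adj a2 v = false.
  move=> vr; rewrite ea2 ?inE ?vr ?orbT //=; apply/negbTE.
  by have /andP[wr' _] := ipath_uniq iwr; apply: contraNneq wr' => <-.
apply/and4P; split.
- by apply: contraNneq ar => <-.
- by have [] := aqr _ _ a1q wr; rewrite eq_sym.
- apply: (@connect_trans _ _ d).
    apply: (ipath_connect iwr (last_rcons _ _ _)) => u v vr uv; rewrite uv [adj v a2]sym a2' //=.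
    move: vr; rewrite mem_rcons inE => /orP[/eqP->|vr]; first by rewrite da orbT.
    by rewrite ra' ?inE ?vr ?orbT.
  have idq : ipath (@adj G) (d :: rev (a1 :: q)) by rewrite -rev_rcons ipath_rev.
  apply: (ipath_connect idq); rewrite ?last_rev // => u v; rewrite mem_rev => vq uv; rewrite uv /=.
  rewrite [adj v a]sym qa //=; case: (v == a1) => //=.
  by have [] := aqr _ _ vq a2r.
- apply: (@connect_trans _ _ d).
    apply: (ipath_connect ip (last_rcons _ _ _)) => u v vp uv; rewrite uv.
    move: vp; rewrite mem_rcons inE => /orP[/eqP->|vp]; first by rewrite da eq_sym.
    have vp' : v \in s :: p by rewrite inE vp orbT.
    rewrite sym pa //=; case/andP: up => sp' _; rewrite (negbTE (memPn sp' _ vp)) /=.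
    by apply: contraNneq ap => <-.
  have idr : ipath (@adj G) (d :: rev (w :: r)) by rewrite -rev_rcons ipath_rev.
  apply: (ipath_connect idr); rewrite ?last_rev // => u v; rewrite mem_rev => vr uv; rewrite uv ra' //=.
  by apply: contraNneq ar => <-; apply: in_r.
Qed.

Lemma theta_witness a d p q r : theta (@adj G) a d p q r ->
  house_sizes (size p) (size q) (size r) -> has_witness.
Proof.
have chord p' q' r' : theta (@adj G) a d p' q' r' ->
    nilp p' -> house_sizes (size p') (size q') (size r') -> has_witness.
  move=> + /nilP p0; rewrite {p'}p0 => th sz.
  have [/andP[q2 r1]|nq] := boolP ((0 < size q' <= 2) && (1 < size r')).
    exact: chord_short_witness th q2 r1.
  have [/andP[r2 q1]|nr] := boolP ((0 < size r' <= 2) && (1 < size q')).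
    exact: chord_short_witness (theta_swap23 sym th) r2 q1.
  (* As neither arm is short beside a long one, both have at least three vertices. *)
  by apply: (chord_long_witness th); move: sz nq nr; rewrite /house_sizes /=; clear; lia.
move=> th sz; have th12 := theta_swap12 sym th; have th23 := theta_swap23 sym th.
have szC i j k : house_sizes i j k -> house_sizes j i k /\ house_sizes k i j.
  by clear; rewrite /house_sizes; lia.
have [p0|p0] := boolP (nilp p); first exact: chord th p0 sz.
have [q0|q0] := boolP (nilp q); first exact: chord th12 q0 (szC _ _ _ sz).1.
have [r0|r0] := boolP (nilp r); first exact: chord (theta_swap12 sym th23) r0 (szC _ _ _ sz).2.
have [r1|r1] := boolP (1 < size r); first exact: theta_long_witness th p0 q0 r1.
have [q1|q1] := boolP (1 < size q); first exact: theta_long_witness th23 p0 r0 q1.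
have [p1|p1] := boolP (1 < size p).
  exact: theta_long_witness (theta_swap23 sym th12) q0 r0 p1.
by move: sz; rewrite /house_sizes (negbTE p1) (negbTE q1) (negbTE r1) !andbF.
Qed.

End Completeness.

(** * The formula *)

Definition FOr (f g : form) : form := FNot (FAnd (FNot f) (FNot g)).

(** [FEq 0 0] serves as truth, which requires variable 0 to be in scope. *)
Definition FAll (fs : seq form) : form := foldr FAnd (FEq 0 0) fs.

Lemma sat_FOr (G : sgraph) k (e : nat -> G) f g : sat k e (FOr f g) = sat k e f || sat k e g.
Proof. by rewrite /= negb_and !negbK. Qed.

Lemma sat_FAll (G : sgraph) k (e : nat -> G) fs : sat k e (FAll fs) = all (sat k e) fs.
Proof. by elim: fs => [|f fs /= <-//]; rewrite /= eqxx. Qed.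

(** Variables 0 to 5 stand for [a], [d], [b], [c], [s], [t]; 6 and 7 are the ends of a step. *)
Definition short_form : form :=
  FAll [:: FAdj 0 1; FAdj 0 2; FAdj 3 1;
    FOr (FEq 2 3) (FAll [:: FAdj 2 3; FNot (FAdj 2 1); FNot (FAdj 3 0)]);
    FAdj 0 4; FAdj 1 5; FNot (FAdj 4 2); FNot (FAdj 4 3); FNot (FAdj 4 1);
    FNot (FAdj 5 0); FNot (FAdj 5 2); FNot (FAdj 5 3);
    FReach 4 5 (FAnd (FAdj 6 7) (FOr (FEq 7 5)
      (FAll [:: FNot (FAdj 7 0); FNot (FAdj 7 2); FNot (FAdj 7 3); FNot (FAdj 7 1)])))].

(** Variables 0 to 5 stand for [a], [a1], [a2], [w], [s], [z]. *)
Definition long_form : form :=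
  FAll [:: FAdj 0 1; FAdj 0 2; FAdj 0 4; FAdj 2 3; FAdj 2 5;
    FNot (FAdj 1 2); FNot (FAdj 4 1); FNot (FAdj 4 2); FNot (FEq 4 1); FNot (FEq 4 2);
    FNot (FAdj 3 0); FNot (FAdj 3 1); FNot (FEq 3 0); FNot (FEq 3 1);
    FReach 3 1 (FAnd (FAdj 6 7)
      (FOr (FEq 7 1) (FAnd (FNot (FAdj 7 0)) (FNot (FAdj 7 2)))));
    FReach 4 5 (FAll [:: FAdj 6 7; FNot (FAdj 7 0); FNot (FEq 7 0)])].

Definition house_form : form :=
  FEx (FEx (FEx (FEx (FEx (FEx (FOr short_form long_form)))))).

Lemma sat_short_form (G : sgraph) (e : nat -> G) :
  sat 6 e short_form = short_witness (e 0) (e 1) (e 2) (e 3) (e 4) (e 5).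
Proof.
rewrite sat_FAll /short_witness [all _ _]/= negb_and !negbK ?eqxx !andbT.
do 12! congr (_ && _).
by apply: eq_connect => x y; rewrite /= negb_and !negbK ?eqxx !andbT.
Qed.

Lemma sat_long_form (G : sgraph) (e : nat -> G) :
  sat 6 e long_form = long_witness (e 0) (e 1) (e 2) (e 3) (e 4) (e 5).
Proof.
rewrite sat_FAll /long_witness [all _ _]/= !andbT.
do 14! congr (_ && _); congr (_ && _); apply: eq_connect => x y.
  by rewrite /= negb_and !negbK.
by rewrite /= ?eqxx !andbT.
Qed.

Lemma sat_house_form (G : sgraph) :
  (exists e : nat -> G, sat 0 e house_form) <-> has_witness G.
Proof.
split=> [[e]|].
  move=> /existsP[a /existsP[b /existsP[c /existsP[d /existsP[s /existsP[t w]]]]]].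
  have {w} : sat 6 _ (FOr short_form long_form) := w.
  rewrite sat_FOr sat_short_form sat_long_form /= => /orP[w|w]; [left|right];
    by exists a, b, c, d, s, t.
have ex (a b c d s t : G) : short_witness a b c d s t || long_witness a b c d s t ->
    exists e : nat -> G, sat 0 e house_form.
  move=> w; exists (fun=> a); apply/existsP; exists a; apply/existsP; exists b.
  apply/existsP; exists c; apply/existsP; exists d; apply/existsP; exists s.
  apply/existsP; exists t; pose upd (e : nat -> G) k x := [eta e with k |-> x].
  pose e6 := upd (upd (upd (upd (upd (upd (fun=> a) 0 a) 1 b) 2 c) 3 d) 4 s) 5 t.
  have : sat 6 e6 (FOr short_form long_form) by rewrite sat_FOr sat_short_form sat_long_form.
  by [].
by case=> -[a [b [c [d [s [t w]]]]]]; apply: (ex a b c d s t); rewrite w ?orbT.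
Qed.

(** * Thetas under embeddings, and the decision procedure *)

Lemma ipath_map (T S : eqType) (e : rel T) (e' : rel S) (f : T -> S) s :
  injective f -> (forall x y, e' (f x) (f y) = e x y) -> ipath e' (map f s) = ipath e s.
Proof.
move=> f_inj ef; elim: s => //= x s ->; rewrite mem_map // all_map.
congr [&& _, _ & _]; apply: eq_all => y /=; rewrite ef; congr (_ == _).
by case: (s) => [|z t] /=; rewrite (inj_eq f_inj).
Qed.

Lemma theta_map (T S : eqType) (e : rel T) (e' : rel S) (f : T -> S) a d p q r :
  injective f -> (forall x y, e' (f x) (f y) = e x y) ->
  theta e a d p q r -> theta e' (f a) (f d) (map f p) (map f q) (map f r).
Proof.
move=> f_inj ef [ne_ad ad [ip iq ir] [jp jq jr] [pq pr qr]].
have anti_map s t : anti e s t -> anti e' (map f s) (map f t).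
  by move=> st _ _ /mapP[x xs ->] /mapP[y yt ->]; rewrite (inj_eq f_inj) ef; apply: st.
split; rewrite ?(inj_eq f_inj) //.
- by rewrite ef ad /nilp !size_map.
- by rewrite -!map_cons !(ipath_map _ f_inj ef).
- by rewrite -!map_rcons !(ipath_map _ f_inj ef).
- by split; apply: anti_map.
Qed.

Lemma house_minor_witness (G : sgraph) :
  induced_topological_minor house G <-> has_witness G.
Proof.
split.
  move=> [K /subdivision_drawn[a [d [p [q [r [dt sz]]]]]] [S [f f_bij f_adj]]].
  have f_inj : injective (val \o f) by apply: inj_comp val_inj (bij_inj f_bij).
  have th := theta_map f_inj (f_adj : forall x y, adj (val (f x)) (val (f y)) = adj x y)
               (theta_of_drawn dt).
  by apply: (theta_witness th); rewrite !size_map.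
case=> -[a [b [c [d [s [t w]]]]]].
  by have [u [v [p [q [r [th sz]]]]]] := short_witness_theta w; apply: theta_minor th sz.
by have [u [v [p [q [r [th sz]]]]]] := long_witness_theta w; apply: theta_minor th sz.
Qed.

Theorem theorem1p10 :
  poly_time_decidable (fun G : sgraph => induced_topological_minor house G).
Proof.
have [//|prog [c [k dec]]] := @form_poly_time house_form.
exists prog, c, k => G; have [t le_t [h acc]] := dec G; exists t => //; split=> //.
by rewrite acc sat_house_form house_minor_witness.
Qed.
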